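(* There exist an absolute constant $c > 0$ and $n_0$ such that for every integer $n \geq n_0$ and every $\varepsilon = \varepsilon(n) > 0$ the following holds. If $q \geq n/2 - 1$ is a positive integer, then in the $(1:q)$ Client-Waiter game played on $E(K_n)$, Waiter has a strategy to keep Client's graph $K_3$-minor free throughout the game. On the other hand, if $q \leq (1/2 - \varepsilon) n$ is a positive integer, then in the $(1:q)$ Client-Waiter game played on $E(K_n)$, Client has a strategy to build a graph which admits a $K_t$-minor for $t = (\varepsilon n)^{c \varepsilon}$.
   Context: The $(1:q)$ Client-Waiter game on the board $E(K_n)$ is played as follows: in each round Waiter offers Client some number $s$ of previously unoffered (free) edges with $1 \le s \le q+1$ (if fewer free edges remain, he offers at most those); Client claims one of the offered edges and Waiter claims the remaining $s-1$. The game ends when all edges are claimed. Client's graph is the graph on $V(K_n)$ formed by the edges Client claimed. A graph $G$ admits a $K_t$-minor if there exist pairwise disjoint vertex sets $B_1,\dots,B_t \subseteq V(G)$ such that each $G[B_i]$ is connected and for every $i<j$ there is an edge of $G$ between $B_i$ and $B_j$. (A graph is $K_3$-minor free iff it is a forest.) *)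

(* Defs.v *)
From mathcomp Require Import all_boot.

Set Implicit Arguments.
Unset Strict Implicit.
Unset Printing Implicit Defensive.

Section ClientWaiterGame.

Variables (T : finType) (q : nat) (board : {set T}).

(* A round is the set offered by Waiter together with the element of it that
   Client claims; a history lists the rounds played so far, latest first. *)
Definition round := ({set T} * T)%type.
Definition history := seq round.

Definition free (h : history) : {set T} := board :\: \bigcup_(r <- h) r.1.

Definition client_claims (h : history) : {set T} := [set r.2 | r in h].

Definition legal_offer (h : history) (A : {set T}) : bool :=
  (A \subset free h) && (1 <= #|A| <= q.+1).

Fixpoint legal (h : history) : bool :=
  if h is (A, x) :: h' then [&& legal h', legal_offer h' A & x \in A]
  else true.

Definition game_over (h : history) : bool := free h == set0.

Definition waiter_strategy := history -> {set T}.
Definition client_strategy := history -> {set T} -> T.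

Definition valid_waiter (w : waiter_strategy) : Prop :=
  forall h, legal h -> ~~ game_over h -> legal_offer h (w h).

Definition valid_client (s : client_strategy) : Prop :=
  forall h A, legal h -> legal_offer h A -> s h A \in A.

Fixpoint follows_waiter (w : waiter_strategy) (h : history) : bool :=
  if h is (A, _) :: h' then (A == w h') && follows_waiter w h' else true.

Fixpoint follows_client (s : client_strategy) (h : history) : bool :=
  if h is (A, x) :: h' then (x == s h' A) && follows_client s h' else true.

Definition waiter_can_maintain (P : {set T} -> Prop) : Prop :=
  exists2 w, valid_waiter w &
    forall h, legal h -> follows_waiter w h -> P (client_claims h).

Definition client_can_build (P : {set T} -> Prop) : Prop :=
  exists2 s, valid_client s &
    forall h, legal h -> game_over h -> follows_client s h ->
      P (client_claims h).

End ClientWaiterGame.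

Section CliqueMinor.

Variables (V : finType) (adj : rel V).

(* The empty vertex set does not induce a connected graph. *)
Definition connected_in (B : {set V}) : Prop :=
  B != set0 /\
  {in B &, forall x y, connect [rel u v | [&& u \in B, v \in B & adj u v]] x y}.

Definition has_clique_minor (t : nat) : Prop :=
  exists B : 'I_t -> {set V},
    [/\ forall i j, i != j -> [disjoint B i & B j],
        forall i, connected_in (B i)
      & forall i j : 'I_t, i < j ->
          exists x y, [/\ x \in B i, y \in B j & adj x y]].

End CliqueMinor.

Definition complete_edges (n : nat) : {set {set 'I_n}} :=
  [set e : {set 'I_n} | #|e| == 2].

Definition edge_adj (n : nat) (E : {set {set 'I_n}}) : rel 'I_n :=
  [rel x y | (x != y) && ([set x; y] \in E)].

(* Main.v *)
(* Waiter grows a single Client tree on a vertex set [U].  He always offers all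
   free edges between [U] and a few outside vertices, so whichever edge Client
   takes is pendant and no free edge is left inside [U].  Outside vertices are
   sorted by their number of free edges to [U], and [q+1 >= n/2] is exactly what
   is needed for the excess over the quotas below to fit into one offer.

   Client plays the method of conditional expectations for a random subset of
   density [1/Q], [Q] being about [max (q+1) (n/4)]: this keeps [(1 + eps) n]
   edges of his graph and few short cycles, and deleting one edge per short
   cycle leaves a graph of large girth with [a e >= (a+1) n], [a] about [4/eps].
   A minimal subgraph with that density has exponentially growing balls;
   contracting Voronoi cells of radius [2 a i] gives a minor of average degree at
   least [2 * 2^i].  In a minimal such minor every edge lies in many triangles and
   some vertex has small degree, so among any three of its neighbours two have
   many common neighbours; a Ramsey argument then produces [t] hubs joined
   pairwise through distinct common neighbours. *)

Require Import Defs.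
From mathcomp Require Import all_boot all_order all_algebra.
From mathcomp Require Import zify ring lra.
From mathcomp Require Import boolp reals exp.

Set Implicit Arguments.
Unset Strict Implicit.
Unset Printing Implicit Defensive.

(** * Strategies from one-round invariants *)

Section Invariants.

Variables (T : finType) (q : nat) (board : {set T}).
Variable Inv : history T -> Prop.

(** Since a strategy sees the whole history, a good offer can be picked separately for each history
    by choice; induction over the rounds then carries [Inv] along. *)
Lemma waiter_maintain_of_invariant (P : {set T} -> Prop) :
  Inv [::] ->
  (forall h, Inv h -> P (client_claims h)) ->
  (forall h, legal q board h -> Inv h -> ~~ game_over board h ->
     exists2 A, legal_offer q board h A & forall x, x \in A -> Inv ((A, x) :: h)) ->
  waiter_can_maintain q board P.
Proof.
move=> I0 IP Istep.
have ch (h : history T) : exists A, legal q board h -> ~~ game_over board h ->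
    legal_offer q board h A /\ (Inv h -> forall x, x \in A -> Inv ((A, x) :: h)).
  case: (pselect (legal q board h)) => lh; last by exists set0.
  case: (boolP (game_over board h)) => go; first by exists set0.
  case: (pselect (Inv h)) => Ih; first by have [A lA HA] := Istep h lh Ih go; exists A.
  (* Validity also concerns legal histories at which [Inv] fails; a single free element is a legal
     offer there. *)
  have [e ef] := set0Pn _ go.
  exists [set e] => _ _; split => //.
  by rewrite /legal_offer sub1set ef cards1.
exists (fun h => projT1 (cid (ch h))) => [h lh go|h].
  by case: (cid (ch h)) => A /= /(_ lh go) [].
move=> lh fh; apply: IP; elim: h lh fh => //= -[A x] h IH.
move=> /and3P[lh lA xA] /andP[/eqP eA fh].
have go : ~~ game_over board h.
  rewrite /game_over; apply: contraTneq lA => f0.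
  by rewrite /legal_offer f0 subset0; case: eqP => [->|]; rewrite ?cards0 ?andbF.
by move: eA; case: (cid (ch h)) => B /= /(_ lh go) [_ HB] eA; subst B; exact: HB (IH lh fh) x xA.
Qed.

Lemma client_build_of_invariant (x0 : T) (P : {set T} -> Prop) :
  Inv [::] ->
  (forall h, Inv h -> game_over board h -> P (client_claims h)) ->
  (forall h A, legal q board h -> Inv h -> legal_offer q board h A ->
     exists2 x, x \in A & Inv ((A, x) :: h)) ->
  client_can_build q board P.
Proof.
move=> I0 IP Istep.
have ch (h : history T) A : exists x, legal q board h -> legal_offer q board h A ->
    x \in A /\ (Inv h -> Inv ((A, x) :: h)).
  (* The default [x0] is returned only on illegal histories or illegal offers. *)
  case: (pselect (legal q board h)) => lh; last by exists x0.
  case: (boolP (legal_offer q board h A)) => lA; last by exists x0.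
  case: (pselect (Inv h)) => Ih; first by have [x xA Hx] := Istep h A lh Ih lA; exists x.
  have /card_gt0P[x xA] : 0 < #|A| by case/and3P: lA.
  by exists x.
exists (fun h A => projT1 (cid (ch h A))) => [h A lh lA|h].
  by case: (cid (ch h A)) => x /= /(_ lh lA) [].
move=> lh go fh; apply: IP => // {go}; elim: h lh fh => //= -[A x] h IH.
move=> /and3P[lh lA xA] /andP[/eqP eA fh].
by move: eA; case: (cid (ch h A)) => y /= /(_ lh lA) [_ Hy] ->; exact: Hy (IH lh fh).
Qed.

End Invariants.

(** * Pendant edges and triangle minors *)

Section Pendant.

Variables (V : finType) (adj adj' : rel V) (w x : V).
Hypothesis wx : w != x.
Hypothesis adj'wl : forall z, adj' w z -> z = x.
Hypothesis adj'wr : forall z, adj' z w -> z = x.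
Hypothesis adj'E : forall y z, y != w -> z != w -> adj' y z -> adj y z.

(** The leaf [w] can be deleted from the model. No branch set is [{w}], since the two others would
    both need its only neighbour [x]. So a branch set containing [w] contains [x], no edge to
    another branch set uses [w], and paths survive when [w] is retracted to [x]. *)
Lemma pendant_clique_minor3 : has_clique_minor adj' 3 -> has_clique_minor adj 3.
Proof.
case=> B [Bdis Bcon Bedge].
have Bdisx i j y : y \in B i -> y \in B j -> i = j.
  move=> yi yj; apply/eqP; apply: contraT => /Bdis /pred0P /(_ y) /=.
  by rewrite yi yj.
have nbw i j : i != j -> B i = [set w] -> x \in B j.
  move=> ij Bi.
  have [lij|lji] : i < j \/ j < i by move: ij; rewrite -val_eqE /=; lia.
    have [y [z [yB zB yz]]] := Bedge _ _ lij.
    by move: yB yz; rewrite Bi inE => /eqP -> /adj'wl <-.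
  have [y [z [yB zB yz]]] := Bedge _ _ lji.
  by move: zB yz; rewrite Bi inE => /eqP -> /adj'wr <-.
have B0 i : exists2 y, y \in B i & y != w.
  case: (boolP (B i \subset [set w])) => [|/subsetPn[y yB]]; last first.
    by rewrite inE => ?; exists y.
  rewrite subset1 (negbTE (Bcon i).1) orbF => /eqP Bi.
  have [j [k [ij ik jk]]] : exists j k : 'I_3, [/\ i != j, i != k & j != k].
    case: i {Bi} => -[|[|[|//]]] hi;
      [exists (inord 1), (inord 2)|exists (inord 0), (inord 2)|exists (inord 0), (inord 1)];
      by rewrite -!val_eqE /= ?inordK.
  by move: jk; rewrite (Bdisx _ _ _ (nbw _ _ ij Bi) (nbw _ _ ik Bi)) eqxx.
have wB i : w \in B i -> x \in B i.
  move=> wBi; have [y yB yw] := B0 i.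
  have /connectP[[/= _ e|z p /= /andP[/and3P[_ zB /adj'wl <-] _] _]] := (Bcon i).2 _ _ wBi yB => //.
  by rewrite e eqxx in yw.
pose B' i := B i :\ w; exists B'; split=> [i j ij|i|i j ij].
- apply/pred0P => y /=; rewrite !inE; apply/negP => /andP[/andP[_ yi] /andP[_ yj]].
  by rewrite (Bdisx _ _ _ yi yj) eqxx in ij.
- split; first by have [y yB yw] := B0 i; apply/set0Pn; exists y; rewrite !inE yw.
  set r := [rel u v | [&& u \in B' i, _ & _]].
  pose f y := if y == w then x else y.
  have fr y z : y \in B i -> z \in B i -> adj' y z -> connect r (f y) (f z).
    move=> yB zB; rewrite /f; case: (y =P w) => [->|/eqP yw].
      move=> /adj'wl ->; rewrite eq_sym (negbTE wx); exact: connect0.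
    case: (z =P w) => [->|/eqP zw]; first by move=> /adj'wr ->; exact: connect0.
    by move=> a; apply: connect1; rewrite /= !inE yw zw yB zB /= adj'E.
  move=> y z; rewrite !inE => /andP[yw yB] /andP[zw zB].
  have /connectP[p pp e] := (Bcon i).2 _ _ yB zB.
  suff: connect r (f y) (f z) by rewrite /f (negbTE yw) (negbTE zw).
  elim: p y e pp {yw yB} => [|a p IH] y /= e; first by rewrite e connect0.
  by case/andP=> /and3P[yB aB ya] pp; apply: connect_trans (fr _ _ yB aB ya) (IH _ e pp).
- have [y [z [yB zB yz]]] := Bedge _ _ ij.
  have ne : i != j by rewrite -val_eqE /= neq_ltn ij.
  exists y, z; rewrite !inE yB zB !andbT.
  have yw : y != w.
    apply: contraNneq ne => yw; move: yB yz; rewrite yw => yB /adj'wl zx.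
    by apply/eqP/(Bdisx i j x); [exact: wB|rewrite -zx].
  have zw : z != w.
    apply: contraNneq ne => zw; move: zB yz; rewrite zw => zB /adj'wr yx.
    by apply/eqP/(Bdisx i j x); [rewrite -yx|exact: wB].
  by split => //; exact: adj'E.
Qed.

End Pendant.

(** * Waiter's side *)

(* The quota of outside vertices with [j.+1] free edges to Client's tree at
   stage [u], plus one.  It is the balanced integral solution of
   [sum_j quota u j = 2b], [sum_j (j.+1) (quota u j - quota u.+1 j.+1) = b]. *)
Definition quota (b u j : nat) : nat := (b + j) %/ u + (b + (u - j.+1)) %/ u.

(** Raising [b] by one replaces the term [b %/ u] by [(b + u) %/ u], which is larger by one, and
    only shifts the others. *)
Lemma hermite_identity b u : 0 < u -> \sum_(j < u) (b + j) %/ u = b.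
Proof.
case: u => // u _; elim: b => [|b IH].
  by rewrite big1 // => j _; rewrite add0n divn_small.
rewrite big_ord_recr /= addSnnS divnDr // divnn /= -[RHS]addn1 addnA; congr (_ + _).
rewrite -[RHS]IH big_ord_recl addn0 addnC; congr (_ + _).
by apply: eq_bigr => i _; rewrite addSnnS.
Qed.

Lemma sum_ord_rev u (F : nat -> nat) : \sum_(j < u) F (u - j.+1) = \sum_(j < u) F j.
Proof. by rewrite [RHS](reindex_inj rev_ord_inj). Qed.

Lemma sum_quota b u : 0 < u -> \sum_(j < u) quota b u j = b.*2.
Proof.
move=> u0; rewrite big_split /= hermite_identity //.
by rewrite (sum_ord_rev u (fun i => (b + i) %/ u)) hermite_identity // addnn.
Qed.

Lemma quota_rev b u j : j < u -> quota b u (u - j.+1) = quota b u j.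
Proof. by move=> ju; rewrite /quota addnC; congr (_ %/ _ + _); lia. Qed.

(** The quotas are symmetric under reversal of the index, so the mean index is half of [u.-1], and
    the total is [b.*2]. *)
Lemma sum_weighted_quota b u : 0 < u -> \sum_(j < u) j * quota b u j = u.-1 * b.
Proof.
move=> u0; set S := LHS.
suff: S + S = u.-1 * b.*2 by rewrite -mul2n mulnCA; lia.
rewrite {1}/S -(sum_ord_rev u (fun j => j * quota b u j)) -big_split /=.
rewrite -(sum_quota b u0) big_distrr /=; apply: eq_bigr => j _.
by rewrite quota_rev // -mulnDl; congr (_ * _); have := ltn_ord j; lia.
Qed.

(** The second summand keeps its numerator and gets a larger divisor; for the first, a quotient
    [k >= 1] with [k * u.+1 <= b + j.+1] gives [k * u <= b + j]. Hence the truncated differences in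
    the drop sums below are exact. *)
Lemma quota_anti b u j : j < u -> quota b u.+1 j.+1 <= quota b u j.
Proof.
move=> ju; apply: leq_add; last by apply: leq_div2l; lia.
case: (ltnP (b + j) u) => h; first by rewrite divn_small //; lia.
rewrite leq_divRL; last by lia.
set k := (b + j.+1) %/ u.+1.
have : k * u.+1 <= b + j.+1 by exact: leq_trunc_div.
by case: (k) => [|k']; nia.
Qed.

Lemma quota_gt0 b u j : u <= b.*2 -> j < u -> 0 < quota b u j.
Proof.
move=> ub ju; rewrite /quota addn_gt0 !divn_gt0 ?(leq_ltn_trans _ ju) //.
by apply/orP; lia.
Qed.

(** Class sizes stay strictly below the quotas, so at stage [b.*2] every class is empty: this ends
    the process. *)
Lemma quota_last b j : j < b.*2 -> quota b b.*2 j = 1.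
Proof.
move=> jb; rewrite /quota; case: (ltnP j b) => h.
  rewrite divn_small; last lia.
  have -> : b + (b.*2 - j.+1) = b.*2 + (b - j.+1) by lia.
  by rewrite divnDl ?dvdnn // divnn (leq_ltn_trans _ jb) // divn_small //; lia.
rewrite [X in _ + X]divn_small; last lia.
have -> : b + j = b.*2 + (j - b) by lia.
by rewrite divnDl ?dvdnn // divnn (leq_ltn_trans _ jb) // divn_small //; lia.
Qed.

(** Both stages have total [b.*2]. The vertices in excess of the next quotas will be relabelled 0,
    and this identity makes them fit into the new class 0. *)
Lemma sum_quota_drop b u : 0 < u ->
  \sum_(j < u) (quota b u j - quota b u.+1 j.+1) = quota b u.+1 0.
Proof.
move=> u0; rewrite sumnB => [|j _]; last exact: quota_anti.
rewrite sum_quota // -(sum_quota b (ltn0Sn u)) big_ord_recl /=.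
by rewrite (eq_bigr (fun j : 'I_u => quota b u.+1 j.+1)) // addnK.
Qed.

(** The two weighted sums are [u.+1 * b] and [u * b]. Their difference bounds the number of edges
    offered in one round. *)
Lemma sum_weighted_quota_drop b u : 0 < u ->
  \sum_(j < u) j.+1 * (quota b u j - quota b u.+1 j.+1) = b.
Proof.
move=> u0; under eq_bigr => j _ do rewrite mulnBr.
rewrite sumnB => [|j _]; last by rewrite leq_mul2l quota_anti ?orbT.
under eq_bigr => j _ do rewrite mulSn.
rewrite big_split /= sum_quota // sum_weighted_quota //.
have -> : \sum_(j < u) j.+1 * quota b u.+1 j.+1 = u * b.
  by rewrite -(sum_weighted_quota b (ltn0Sn u)) big_ord_recl /= mul0n add0n.
by case: u u0 => // u _; rewrite mulSn; lia.
Qed.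

Lemma free_cons (T : finType) (board : {set T}) A x h :
  Defs.free board ((A, x) :: h) = Defs.free board h :\: A.
Proof. by rewrite /Defs.free big_cons /= setDDl setUC. Qed.

Lemma client_claims_cons (T : finType) (A : {set T}) x h :
  client_claims ((A, x) :: h) = x |: client_claims h.
Proof.
apply/setP => y; rewrite !inE; apply/imsetP/orP.
  case=> r; rewrite inE => /orP[/eqP->|rh] ->; first by left.
  by right; apply/imsetP; exists r.
case=> [/eqP->|/imsetP[r rh ->]]; first by exists (A, x); rewrite ?inE ?eqxx.
by exists r; rewrite // inE rh orbT.
Qed.

Lemma card_bigcup_le (I T : finType) (W : {set I}) (F : I -> {set T}) :
  #|\bigcup_(i in W) F i| <= \sum_(i in W) #|F i|.
Proof.
elim/big_rec2: _ => [|i m A _ IH]; first by rewrite cards0.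
by rewrite cardsU; apply: leq_trans (leq_subr _ _) _; rewrite leq_add2l.
Qed.

Lemma sum_by_label (V : finType) (W : {set V}) (lab : V -> nat) u (f : nat -> nat) :
  (forall w, w \in W -> lab w < u) ->
  \sum_(w in W) f (lab w) = \sum_(j < u) #|[set w in W | lab w == j]| * f j.
Proof.
move=> labu; symmetry.
rewrite (eq_bigr (fun j : 'I_u => \sum_(w in W | lab w == j) f j)) => [|j _]; last first.
  by rewrite -sum_nat_const; apply: eq_bigl => w; rewrite inE.
rewrite (exchange_big_dep (mem W)) /= => [|j w _ /andP[]//].
apply: eq_bigr => w wW; rewrite (big_pred1 (Ordinal (labu w wW))) // => j.
by rewrite /= -val_eqE /= eq_sym; move: wW; rewrite /in_mem /= => ->.
Qed.

Section WaiterStep.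

Variables (n b : nat).
Implicit Types (E F : {set {set 'I_n}}) (U : {set 'I_n}) (lab : 'I_n -> nat).

(* Client's graph lives on [U] and nothing is free inside [U]; a vertex [w]
   outside [U] has between [1] and [(lab w).+1] free edges to [U]. *)
Definition waiter_state F E U u lab : Prop :=
  [/\ (forall e, e \in E -> e \subset U),
      ~ has_clique_minor (edge_adj E) 3,
      (forall x y, x \in U -> y \in U -> x != y -> [set x; y] \notin F),
      (forall x y, x \notin U -> y \notin U -> x != y -> [set x; y] \in F) &
      (forall x, x \notin U -> exists2 y, y \in U & [set x; y] \in F)] /\
  [/\ 0 < u <= b.*2,
      (forall w, w \notin U -> lab w < u),
      (forall w, w \notin U -> #|[set y in U | [set w; y] \in F]| <= (lab w).+1) &
      (forall j, j < u -> #|[set w in ~: U | lab w == j]| < quota b u j)].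

(** The stage advances by one and all labels rise by one. From each class that would reach its new
    quota, the surplus goes into [W], and all free edges between [W] and [U] are offered. Client's
    edge hangs some [w] of [W] onto the tree; the rest of [W] then has a free edge to [w] only and
    gets label 0, while any other outside vertex gains just the edge to [w]. *)
Lemma waiter_state_step F E U u lab :
  waiter_state F E U u lab -> U != setT ->
  exists A : {set {set 'I_n}}, [/\ A \subset F, 0 < #|A| <= b &
    forall e, e \in A -> exists U' u' lab', waiter_state (F :\: A) (e |: E) U' u' lab'].
Proof.
move=> + UT; have [w1 w1U] : exists w, w \notin U.
  by apply/existsP; rewrite -negb_forall; apply: contra UT => /forallP h; apply/eqP/setP => x; rewrite inE h.
have [m] := ubnP (b.*2 - u); elim: m u lab => // m IH u lab um.
case=> -[EU Eminor FU Fout Fin] [/andP[u0 ub] labu labF cls].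
pose C j := [set w in ~: U | lab w == j].
have ub' : u < b.*2.
  rewrite ltn_neqAle ub andbT; apply: contraT; rewrite negbK => /eqP eu.
  have := cls _ (labu _ w1U); rewrite eu quota_last -?eu ?labu //.
  rewrite ltnS leqn0 cards_eq0 => /eqP /setP /(_ w1).
  by rewrite !inE w1U eqxx.
have q0 j : j <= u -> 0 < quota b u.+1 j by move=> ju; apply: quota_gt0.
(* The successor appears because a class must remain strictly smaller than its quota. *)
pose ex j := #|C j|.+1 - quota b u.+1 j.+1.
pose W := [set w in ~: U | w \in take (ex (lab w)) (enum (C (lab w)))].
have WU w : w \in W -> w \notin U by rewrite !inE => /andP[].
have cW j : j < u -> #|[set w in W | lab w == j]| <= quota b u j - quota b u.+1 j.+1.
  move=> ju; apply: (@leq_trans (ex j)); last first.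
    by rewrite /ex leq_sub2r //; exact: cls.
  apply: (@leq_trans (size (take (ex j) (enum (C j))))); last by rewrite size_take; case: ltnP.
  apply: leq_trans (card_size _); apply: subset_leq_card; apply/subsetP => w.
  by rewrite inE => /andP[/setIdP[_ h] /eqP <-].
have cR j : j < u -> #|[set w in ~: U | (w \notin W) && (lab w == j)]| < quota b u.+1 j.+1.
  move=> ju; apply: (@leq_ltn_trans (size (drop (ex j) (enum (C j))))); last first.
    by rewrite size_drop -cardE /ex; have := q0 _ ju; lia.
  apply: leq_trans (card_size _); apply: subset_leq_card; apply/subsetP => w.
  rewrite inE => /andP[wU /andP[wW /eqP lw]].
  have : w \in enum (C j) by rewrite mem_enum !inE -in_setC wU lw eqxx.
  rewrite -{1}(cat_take_drop (ex j) (enum _)) mem_cat => /orP[|//].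
  by move: wW; rewrite inE wU /= lw => /negbTE ->.
have labW w : w \in W -> lab w < u by move=> /WU /labu.
have sW : #|W| <= quota b u.+1 0.
  rewrite -sum1_card (sum_by_label (fun=> 1) labW) -(sum_quota_drop b u0).
  by apply: leq_sum => j _; rewrite muln1 cW.
have sW1 : \sum_(w in W) (lab w).+1 <= b.
  rewrite (sum_by_label S labW) -[X in _ <= X](sum_weighted_quota_drop b u0).
  by apply: leq_sum => j _; rewrite mulnC leq_mul2l cW.
(* Without surplus there is nothing to offer: the stage advances for free, and the induction on
   [b.*2 - u] continues. *)
have [W0|] := eqVneq W set0.
  apply: (IH u.+1 (S \o lab)); first by lia.
  split; first by [].
  split=> [|w wU|w wU|[|j] ju] /=.
  - by [].
  - by rewrite ltnS labu.
  - exact: leq_trans (labF w wU) _.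
  - rewrite (_ : [set w in _ | _] = set0) ?cards0 ?q0 //.
    by apply/setP => w; rewrite !inE andbF.
  - apply: leq_ltn_trans (cR j ju); apply: subset_leq_card; apply/subsetP => w.
    by rewrite W0 !inE.
case/set0Pn => w0 w0W.
pose N w := [set y in U | [set w; y] \in F].
pose A := \bigcup_(w in W) [set [set w; y] | y in N w].
have AP e : reflect (exists w y, [/\ w \in W, y \in U, [set w; y] \in F & e = [set w; y]]) (e \in A).
  apply: (iffP bigcupP) => [[w wW /imsetP[y /setIdP[yU yF] ->]]|[w [y [wW yU yF ->]]]].
    by exists w, y.
  by exists w => //; apply/imsetP; exists y; rewrite ?inE ?yU.
exists A; split=> [||e /AP[w [y [wW yU wyF ->]]]].
- by apply/subsetP => e /AP[w [y [_ _ ? ->]]].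
- apply/andP; split.
    have [y yU yF] := Fin _ (WU _ w0W).
    by apply/card_gt0P; exists [set w0; y]; apply/AP; exists w0, y.
  apply: leq_trans (card_bigcup_le _ _) (leq_trans _ sW1); apply: leq_sum => w wW.
  by apply: leq_trans (leq_imset_card _ _) (labF _ (WU _ wW)).
exists (w |: U), u.+1, (fun v => if v \in W then 0 else (lab v).+1).
have wU := WU _ wW.
have wy : w != y by apply: contraNneq wU => ->.
have Eout f : f \in E -> w \notin f by move=> /EU /subsetP h; apply: contra wU; exact: h.
have outA x z : x \notin U -> z \notin U -> [set x; z] \notin A.
  move=> xU zU; apply/AP => -[w' [y' [_ y'U _ /setP/(_ y')]]].
  rewrite !inE eqxx orbT => /orP[] /eqP y'x; first by rewrite -y'x y'U in xU.
  by rewrite -y'x y'U in zU.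
split; split.
- move=> f; rewrite inE => /orP[/set1P ->|/EU eU].
    by rewrite subUset !sub1set !inE eqxx yU orbT.
  by apply: subset_trans eU (subsetUr _ _).
- move=> M; apply: Eminor; apply: pendant_clique_minor3 wy _ _ _ M.
  + move=> z; rewrite /edge_adj /= !inE => /andP[wz /orP[/eqP/setP/(_ z)|/Eout]]; rewrite !inE eqxx ?orbT //.
    by move/esym; rewrite eq_sym (negbTE wz) /= => /eqP.
  + move=> z; rewrite /edge_adj /= !inE => /andP[wz /orP[/eqP/setP/(_ z)|/Eout]]; rewrite !inE eqxx ?orbT //.
    by move/esym; rewrite (negbTE wz) /= => /eqP.
  + move=> y' z' yw zw; rewrite /edge_adj /= !inE => /andP[-> /= /orP[/eqP/setP/(_ w)|//]].
    by rewrite !inE eqxx /= eq_sym (negbTE yw) eq_sym (negbTE zw).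
- have key z : z \in U -> [set w; z] \notin F :\: A.
    move=> zU; rewrite inE; apply/negP => /andP[/AP nA zF]; apply: nA.
    by exists w, z.
  move=> x z; rewrite !inE => /orP[/eqP->|xU] /orP[/eqP->|zU]; rewrite ?eqxx // => xz.
  + by have := key z zU; rewrite inE.
  + by have := key x xU; rewrite inE setUC.
  + by rewrite (negbTE (FU _ _ xU zU xz)) andbF.
- move=> x z; rewrite !inE !negb_or => /andP[_ xU] /andP[_ zU] xz.
  by rewrite Fout // outA.
- move=> x; rewrite !inE negb_or => /andP[xw xU].
  by exists w; rewrite !inE ?eqxx // outA // Fout.
- by [].
- move=> x; rewrite !inE negb_or => /andP[xw xU]; case: ifP => // _.
  by rewrite ltnS labu.
- move=> x; rewrite in_setU in_set1 negb_or => /andP[xw xU].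
  have sub : [set z in w |: U | [set x; z] \in F :\: A] \subset
             w |: (if x \in W then set0 else N x).
    apply/subsetP => z; rewrite !inE => /and3P[/orP[->//|zU] xA xF].
    apply/orP; right; case: ifP => xW; last by rewrite inE zU.
    by move/AP: xA; case; exists x, z; split=> //; rewrite !inE.
  apply: leq_trans (subset_leq_card sub) _; rewrite cardsU1.
  rewrite -[X in _ <= X]add1n; apply: leq_add; first by case: (_ \notin _).
  by move: (labF _ xU); rewrite /N; case: ifP; rewrite ?cards0.
- case=> [|j] ju.
    (* Since [w] itself moves into [U], the bound on [W] becomes strict for the new class 0. *)
    apply: leq_trans sW; rewrite [X in _ < X](cardsD1 w) wW add1n ltnS.
    apply: subset_leq_card; apply/subsetP => x; rewrite !inE negb_or => /andP[/andP[-> ->]] /=.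
    by case: ifP.
  apply: leq_ltn_trans (cR j ju); apply: subset_leq_card; apply/subsetP => x.
  by rewrite !inE negb_or => /andP[/andP[_ ->]] /=; case: ifP.
Qed.

End WaiterStep.

Theorem waiter_keeps_forest n q : 0 < n -> n <= q.+1.*2 ->
  waiter_can_maintain q (complete_edges n) (fun E => ~ has_clique_minor (edge_adj E) 3).
Proof.
move=> n0 nb; pose v0 : 'I_n := Ordinal n0.
pose Inv h := exists U u lab,
  @waiter_state n q.+1 (Defs.free (complete_edges n) h) (client_claims h) U u lab.
apply: (@waiter_maintain_of_invariant _ _ _ Inv).
(* At stage 1 the only quota is [q.+1.*2 >= n], which exceeds the number of vertices other than
   [v0]. *)
- exists [set v0], 1, (fun=> 0).
  have E0 : client_claims [::] = set0 :> {set {set 'I_n}}.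
    by apply/setP => e; rewrite inE; apply/imsetP => -[].
  rewrite E0 /Defs.free big_nil setD0.
  have ed (x y : 'I_n) : x != y -> [set x; y] \in complete_edges n by move=> xy; rewrite inE cards2 xy.
  split; split=> //.
  + by move=> e; rewrite inE.
  + case=> B [Bdis _ Be].
    by have [x [y [_ _]]] := Be (inord 0) (inord 1) ltac:(rewrite !inordK //); rewrite /edge_adj /= inE andbF.
  + by move=> x y /set1P-> /set1P->; rewrite eqxx.
  + by move=> x y _ _ /ed.
  + by move=> x; rewrite inE => /ed h; exists v0; rewrite // inE.
  + move=> w _; rewrite -(cards1 v0); apply: subset_leq_card; apply/subsetP => y.
    by rewrite !inE => /andP[].
  + case=> // _; rewrite (_ : quota _ _ _ = q.+1.*2); last by rewrite /quota !divn1; lia.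
    apply: leq_trans nb; rewrite -[X in _ < X](card_ord n) -cardsT.
    by apply: proper_card; apply/properP; split; [exact: subsetT|exists v0; rewrite !inE ?eqxx].
- by move=> h [U [u [lab [[]]]]].
- move=> h lh [U [u [lab st]]] go.
  have UT : U != setT.
    apply: contra go => /eqP UT; case: st => -[_ _ FU _ _] _.
    apply/eqP/setP => e; rewrite [RHS]inE; apply/negP => eF.
    have := eF; rewrite /Defs.free in_setD inE => /andP[_ /cards2P[x [y [xy exy]]]].
    by move: (FU x y); rewrite UT -exy eF !inE => /(_ isT isT xy).
  have [A [AF Ab HA]] := waiter_state_step st UT.
  exists A => [|x /HA [U' [u' [lab' st']]]]; first by rewrite /legal_offer AF.
  by exists U', u', lab'; rewrite free_cons client_claims_cons.
Qed.

(** * A sparse obstruction-free claim for Client *)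

Section Potential.

Import Order.TTheory GRing.Theory Num.Theory.
Local Open Scope ring_scope.

Variables (R : realFieldType) (T I : finType) (J : {set I}) (F : I -> {set T}) (p : R).
Hypothesis p_gt0 : 0 < p.
Implicit Types (K D A : {set T}) (i : I).

(** The probability that all of [F i] is kept, given that [K] is kept, [D] is undecided and
    everything else is lost. *)
Definition hazard (K D : {set T}) (i : I) : R :=
  if F i \subset K :|: D then p ^+ #|F i :\: K| else 0.

(* The conditional expectation of (kept edges) - (completed obstructions) if
   every element still in [D] were kept independently with probability [p]. *)
Definition potential (K D : {set T}) : R :=
  #|K|%:R + p * #|D|%:R - \sum_(i in J) hazard K D i.

(** The left side averages over a random round: each element of [A] is the one kept with probability
    [p], and none is kept otherwise. Obstructions meeting [A] in at most one element keep their
    hazard; those meeting it twice can no longer be completed. *)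
Lemma hazard_average K D A i : [disjoint K & D] -> A \subset D -> p * #|A|%:R <= 1 ->
  (1 - p * #|A|%:R) * hazard K (D :\: A) i +
    p * \sum_(x in A) hazard (x |: K) (D :\: A) i <= hazard K D i.
Proof.
move=> /pred0P KD /subsetP AD pA.
have hz_ge0 L C : 0 <= hazard L C i by rewrite /hazard; case: ifP => // _; rewrite exprn_ge0 ?ltW.
case: (boolP [disjoint F i & A]) => [dA|/pred0Pn[y /= /andP[yF yA]]].
  have FA x : x \in F i -> x \notin A by move=> xF; move/pred0P: dA => /(_ x) /=; rewrite xF /= => ->.
  have e L : (F i \subset L :|: (D :\: A)) = (F i \subset L :|: D).
    by apply/subsetP/subsetP => h x xF; move: (h x xF); rewrite !inE (FA x xF).
  have e0 : hazard K (D :\: A) i = hazard K D i by rewrite /hazard e.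
  rewrite (eq_bigr (fun=> hazard K D i)) => [|x xA]; last first.
    have xF : x \notin F i by apply: contraL xA; exact: FA.
    rewrite /hazard e (_ : F i :\: (x |: K) = F i :\: K); last first.
      apply/setP => z; rewrite !inE negb_or; case: eqP => [->|//].
      by rewrite (negbTE xF) !andbF.
    congr (if _ then _ else _); apply/subsetP/subsetP => h z zF; move: (h z zF); rewrite !inE.
      by case: eqP zF xF => [->->|].
    by case/orP => ->; rewrite ?orbT.
  rewrite e0 sumr_const -mulr_natl; lra.
have yD := AD _ yA.
have yK : y \notin K by apply/negP => yK; have := KD y; rewrite /= yK yD.
rewrite {1}/hazard ifF; last first.
  by apply/negbTE/subsetPn; exists y; rewrite // !inE yA (negbTE yK).
rewrite mulr0 add0r (bigD1 y) //= big1 ?addr0 => [|x /andP[xA xy]]; last first.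
  rewrite /hazard ifF //; apply/negbTE/subsetPn; exists y; rewrite // !inE yA.
  by rewrite (negbTE yK) eq_sym (negbTE xy).
rewrite {1}/hazard; case: ifP => [/subsetP h|_]; last by rewrite mulr0.
rewrite /hazard ifT.
  rewrite -exprS (cardsD1 y (F i :\: K)) !inE yK yF /= add1n.
  by rewrite (_ : F i :\: K :\ y = F i :\: (y |: K)) // setDDl setUC.
apply/subsetP => z /h; rewrite !inE => /orP[/orP[/eqP->|->//]|/andP[_ ->]]; last by rewrite orbT.
by rewrite yD orbT.
Qed.

(** The same random round does not lower the potential on average, so some outcome of positive
    weight does not lower it either. *)
Lemma potential_step K D A : [disjoint K & D] -> A \subset D -> p * #|A|%:R <= 1 ->
  A != set0 -> potential K D <= potential K (D :\: A) \/
  exists2 x, x \in A & potential K D <= potential (x |: K) (D :\: A).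
Proof.
move=> dKD AD pA A0.
case: (lerP (potential K D) (potential K (D :\: A))) => [|lt0]; first by left.
right; apply/exists_inP; apply: contraT; rewrite negb_exists_in => /forall_inP lt.
have : (1 - p * #|A|%:R) * (potential K (D :\: A) - potential K D) +
   p * \sum_(x in A) (potential (x |: K) (D :\: A) - potential K D) < 0.
  rewrite -[X in _ < X]addr0 ler_ltD //.
    by rewrite mulr_ge0_le0 ?subr_ge0 // subr_le0 ltW.
  rewrite pmulr_rlt0 //; have [y yA] := set0Pn _ A0.
  rewrite (bigD1 y) //= -[X in _ < X]addr0 ltr_leD ?subr_lt0 ?ltNge ?lt //.
  by apply: sumr_le0 => x /andP[xA _]; rewrite subr_le0 ltW // ltNge lt.
suff h : 0 <= (1 - p * #|A|%:R) * (potential K (D :\: A) - potential K D) +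
   p * \sum_(x in A) (potential (x |: K) (D :\: A) - potential K D) by rewrite ltNge h.
have cD : #|D :\: A|%:R = #|D|%:R - #|A|%:R :> R.
  by rewrite cardsD (setIidPr AD) natrB // subset_leq_card.
have cx x : x \in A -> #|x |: K|%:R = 1 + #|K|%:R :> R.
  move=> xA; rewrite cardsU1; move/pred0P/(_ x): dKD => /=.
  by rewrite (subsetP AD _ xA) andbT => ->; rewrite natrD.
have eS : \sum_(x in A) (potential (x |: K) (D :\: A) - potential K D) =
  #|A|%:R * (1 - p * #|A|%:R + \sum_(i in J) hazard K D i) - \sum_(i in J) \sum_(x in A) hazard (x |: K) (D :\: A) i.
  rewrite exchange_big /= mulr_natl -sumr_const -sumrB; apply: eq_bigr => x xA.
  by rewrite /potential cD cx //; ring.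
rewrite eS /potential cD.
have : \sum_(i in J) ((1 - p * #|A|%:R) * hazard K (D :\: A) i +
    p * \sum_(x in A) hazard (x |: K) (D :\: A) i) <= \sum_(i in J) hazard K D i.
  by apply: ler_sum => i _; exact: hazard_average.
rewrite big_split /= -!mulr_sumr.
move: (\sum_(i in J) hazard K (D :\: A) i) (\sum_(i in J) \sum_(x in A) _) (\sum_(i in J) _) => s0 s1 s.
lra.
Qed.

Lemma client_builds_sparse (q : nat) (board : {set T}) (x0 : T) :
  p * q.+1%:R <= 1 ->
  client_can_build q board (fun E => exists K : {set T},
    [/\ K \subset E, K \subset board &
        p * #|board|%:R - \sum_(i in J) p ^+ #|F i| <=
          #|K|%:R - #|[set i in J | F i \subset K]|%:R]).
Proof.
move=> pq; set P0 := _ - _.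
pose Inv h := exists K : {set T}, [/\ K \subset client_claims h,
  K \subset board :\: Defs.free board h & P0 <= potential K (Defs.free board h)].
apply: (@client_build_of_invariant _ _ _ Inv) => //.
- exists set0; rewrite !sub0set; split=> //.
  rewrite /P0 /potential cards0 add0r /Defs.free big_nil setD0 lerD2l lerN2.
  apply: ler_sum => i _; rewrite /hazard setD0; case: ifP => // _.
  by rewrite exprn_ge0 ?ltW.
- move=> h [K [KE Kb Pk]] /eqP f0; exists K; split=> //.
    by apply: subset_trans Kb (subsetDl _ _).
  apply: le_trans Pk _; rewrite /potential f0 cards0 mulr0 addr0 lerD2l lerN2.
  rewrite -sum1_card natr_sum big_mkcond [X in _ <= X]big_mkcond /=.
  apply: ler_sum => i _; rewrite /hazard setU0 inE; case: (i \in J) => //=; case: ifP => //.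
  by rewrite -setD_eq0 => /eqP ->; rewrite cards0.
move=> h A lh [K [KE Kb Pk]] /andP[Af /andP[A0 Aq]].
have dKD : [disjoint K & Defs.free board h].
  by apply/pred0P => x /=; apply/negP => /andP[/(subsetP Kb)]; rewrite !in_setD => /andP[/negbTE->].
have pA : p * #|A|%:R <= 1 by apply: le_trans pq; rewrite ler_pM2l // ler_nat.
have An0 : A != set0 by rewrite -card_gt0.
(* When keeping nothing is the good outcome, Client still claims an edge but leaves it out of
   [K]. *)
have [le|[x xA le]] := potential_step dKD Af pA An0.
  have [x xA] := card_gt0P A0.
  exists x => //; exists K; rewrite free_cons client_claims_cons; split.
  - exact: subset_trans KE (subsetUr _ _).
  - by apply: subset_trans Kb _; apply: setDS; exact: subsetDl.
  - exact: le_trans le.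
exists x => //; exists (x |: K); rewrite free_cons client_claims_cons; split.
- exact: setUS.
- rewrite subUset sub1set; apply/andP; split.
    by rewrite !in_setD xA /=; have := subsetP Af _ xA; rewrite in_setD => /andP[].
  by apply: subset_trans Kb _; apply: setDS; exact: subsetDl.
- exact: le_trans le.
Qed.

End Potential.

(** * Short cycles and the girth of Client's graph *)

Section CycleEdges.

Variable V : finType.
Implicit Type c : seq V.

Definition cycle_edges c : {set {set V}} := [set [set x; next c x] | x in c].

Lemma next2_neq c x : uniq c -> 2 < size c -> x \in c ->
  next c x != x /\ next c (next c x) != x.
Proof.
move=> uc c2 xc; case: (rot_to xc) => i s e.
have us : uniq (x :: s) by rewrite -e rot_uniq.
have nE : next (x :: s) =1 next c by move=> y; rewrite -e next_rot.
have : 2 < size (x :: s) by rewrite -e size_rot.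
rewrite -!nE; case: s us {e nE} => [|y [|z s]] //= /and3P[]; rewrite !inE !negb_or.
move=> /and3P[xy xz _] _ _ _; rewrite eqxx; split; first by rewrite eq_sym.
by rewrite [y == x]eq_sym (negbTE xy) eqxx eq_sym.
Qed.

(** If the edges leaving two distinct vertices coincided, each vertex would be the successor of the
    other, so two steps along [c] would return to the start. *)
Lemma card_cycle_edges c : uniq c -> 2 < size c -> #|cycle_edges c| = size c.
Proof.
move=> uc c2; rewrite card_in_imset ?(card_uniqP uc) // => x y xc yc e.
have [nx nnx] := next2_neq uc c2 xc.
apply/eqP; apply: contraT => xy.
have : x \in [set y; next c y] by rewrite -e !inE eqxx.
rewrite !inE (negbTE xy) /= => /eqP xny.
have : y \in [set x; next c x] by rewrite e !inE eqxx.
rewrite !inE eq_sym (negbTE xy) /= => /eqP ynx.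
by rewrite -ynx -xny eqxx in nnx.
Qed.

End CycleEdges.

(** An edge traversed back and forth is a [ucycle] of size 2, hence the lower bound on the size. *)
Definition girth_gt (V : finType) (adj : rel V) (L : nat) : Prop :=
  forall c, ucycle adj c -> 2 < size c -> L < size c.

Section ClientGirth.

Import Order.TTheory GRing.Theory Num.Theory.

(** There are [n ^ l] tuples of length [l], so length [l] contributes at most [4 ^ l]. This bounds
    the expected number of kept cycles of length at most [L]. *)
Lemma sum_tuple_weights (p : rat) (n L : nat) : (0 <= p -> n%:R * p <= 4 ->
  \sum_(i : {l : 'I_L.+1 & l.-tuple 'I_n}) p ^+ tag i <= 4 ^+ L.+1)%R.
Proof.
move=> p0 np.
have -> : (\sum_(i : {l : 'I_L.+1 & l.-tuple 'I_n}) p ^+ tag i =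
  \sum_(l < L.+1) \sum_(c : l.-tuple 'I_n) p ^+ l)%R.
  by rewrite sig_big_dep.
apply: (@le_trans _ _ (\sum_(l < L.+1) 4 ^+ l))%R.
  apply: ler_sum => l _; rewrite sumr_const card_tuple card_ord -[(_ *+ _)%R]mulr_natl natrX -exprMn.
  by rewrite lerXn2r ?nnegrE // mulr_ge0 ?ler0n.
elim: L => [|L IH]; first by rewrite big_ord1.
rewrite big_ord_recr /=; apply: le_trans (lerD IH (lexx _)) _.
rewrite [(4 ^+ L.+2)%R]exprS.
have : (0 <= 4 ^+ L.+1 :> rat)%R by rewrite exprn_ge0.
by move: (4 ^+ L.+1)%R => z; lra.
Qed.

(** The sparse claim is used with [p = 1/Q] and the cycles of length at most [L] as obstructions;
    then one edge of each completed cycle is deleted. [q < Q] makes a round a probability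
    distribution, and [n <= 4 * Q] bounds the cycle count. *)
Lemma client_builds_high_girth n q Q L : 1 < n -> q < Q -> n <= 4 * Q ->
  client_can_build q (complete_edges n) (fun E =>
    exists K : {set {set 'I_n}}, [/\ K \subset E, K \subset complete_edges n,
      girth_gt (edge_adj K) L & 'C(n, 2) <= Q * (#|K| + 4 ^ L.+1)]).
Proof.
move=> n1 qQ nQ.
have Q0 : 0 < Q by apply: leq_ltn_trans qQ.
have Q0' : (0 < Q%:R :> rat)%R by rewrite ltr0n.
pose I := {l : 'I_L.+1 & l.-tuple 'I_n}.
pose J := [set i : I | uniq (tagged i) && (2 < tag i)].
pose F (i : I) := cycle_edges (tagged i).
pose p : rat := (Q%:R^-1)%R.
have p0 : (0 < p)%R by rewrite invr_gt0.
have pq : (p * q.+1%:R <= 1)%R by rewrite mulrC ler_pdivrMr // mul1r ler_nat.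
have [s vs Hs] := client_builds_sparse J F p0 (complete_edges n) set0 pq.
exists s => // h lh go fh; have [K [KE Kb le]] := Hs h lh go fh.
pose S := [set i in J | F i \subset K].
pose f i := odflt set0 [pick e in F i].
exists (K :\: f @: S); split.
- exact: subset_trans (subsetDl _ _) KE.
- exact: subset_trans (subsetDl _ _) Kb.
- move=> c /andP[cc uc] c2; rewrite ltnNge; apply/negP => cL.
  have lc : size c < L.+1 by [].
  pose i : I := Tagged (fun l : 'I_L.+1 => l.-tuple 'I_n) (in_tuple c : (Ordinal lc).-tuple 'I_n).
  have iJ : i \in J by rewrite inE /= uc.
  have FK : F i \subset K :\: f @: S.
    by apply/subsetP => e /imsetP[x xc ->]; case/andP: (next_cycle cc xc).
  have iS : i \in S by rewrite inE iJ (subset_trans FK (subsetDl _ _)).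
  have F0 : 0 < #|F i| by rewrite card_cycle_edges // (ltn_trans _ c2).
  have fF : f i \in F i.
    by rewrite /f; case: pickP => //= F0'; case/card_gt0P: F0 => e eF; have := F0' e; rewrite /= eF.
  have := subsetP FK _ fF; rewrite in_setD => /andP[/negP[]]; exact: imset_f.
have cS : #|K| <= #|K :\: f @: S| + #|S|.
  rewrite cardsD; apply: leq_trans (leq_add (leqnn _) (leq_imset_card f S)).
  by rewrite addnC -leq_subLR leq_sub2l // subset_leq_card // subsetIr.
have hs : (\sum_(i in J) p ^+ #|F i| <= 4 ^+ L.+1)%R.
  apply: le_trans (@sum_tuple_weights p n L (ltW p0) _).
    rewrite big_mkcond; apply: ler_sum => i _; case: ifP => [|_]; last by rewrite exprn_ge0 // ltW.
    rewrite inE => /andP[ui i2]; rewrite card_cycle_edges ?size_tuple //.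
  by rewrite ler_pdivrMr // -natrM ler_nat.
have cb : #|complete_edges n| = 'C(n, 2).
  by rewrite -[in RHS](card_ord n) -cardsT -cards_draws; apply: eq_card => e; rewrite !inE subsetT.
rewrite -(ler_nat rat) natrM natrD natrX -ler_pdivrMl // -/p.
move: le hs; rewrite cb; have : (#|K|%:R <= #|K :\: f @: S|%:R + #|S|%:R :> rat)%R.
  by rewrite -natrD ler_nat.
by rewrite -/S; lra.
Qed.

End ClientGirth.

(** * Balls and clusters in graphs of large girth *)

Section Walks.

Variable V : finType.
Implicit Types (r : rel V) (x y z : V) (m : nat).

Definition walk r x y m := exists p, [/\ path r x p, last x p = y & size p <= m].

Lemma walk0 r x m : walk r x x m.
Proof. by exists [::]. Qed.

Lemma walk1 r x y : r x y -> walk r x y 1.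
Proof. by move=> rxy; exists [:: y]; rewrite /= rxy. Qed.

Lemma walk_trans r y x z m1 m2 : walk r x y m1 -> walk r y z m2 -> walk r x z (m1 + m2).
Proof.
move=> [p [pp lp sp]] [q [pq lq sq]]; exists (p ++ q).
by rewrite cat_path last_cat size_cat lp pp pq lq leq_add.
Qed.

Lemma walk_sym r x y m : symmetric r -> walk r x y m -> walk r y x m.
Proof.
move=> sr [p [pp lp sp]]; exists (rev (belast x p)); split.
- by rewrite -lp rev_path; under eq_path => u v do rewrite sr.
- by case: p pp lp sp => //= a p _ _ _; rewrite rev_cons last_rcons.
- by rewrite size_rev size_belast.
Qed.

Lemma walk_mono r r' x y m m' : (forall u v, r u v -> r' u v) -> m <= m' ->
  walk r x y m -> walk r' x y m'.
Proof.
move=> rr mm [p [pp lp sp]]; exists p; split=> //; first exact: sub_path pp.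
exact: leq_trans mm.
Qed.

(** The walk shortens to a simple path, which the step from [y] to [x] closes to a cycle. Its size
    exceeds 2 because the path is not the step [(x, y)] itself; the reverse step needs no exclusion,
    as a simple path never returns to [x]. *)
Lemma girth_detour r L x y m : girth_gt r L -> x != y -> r y x ->
  walk [rel u v | r u v && ((u, v) != (x, y))] x y m -> L <= m.
Proof.
move=> gL xy ryx [p [pp lp sp]].
move: lp; case: (shortenP pp) => p' pp' up' sub lp.
apply: leq_trans sp; apply: leq_trans (uniq_leq_size _ sub); last by case/andP: up'.
rewrite -ltnS; apply: (gL (x :: p')).
  rewrite /ucycle up' andbT /= rcons_path lp ryx andbT.
  by apply: sub_path pp' => u v /andP[].
case: p' pp' lp {up' sub} => [|a [|b s]] //=.
  by move=> _ e; rewrite e eqxx in xy.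
by move=> /andP[/andP[_ /negP h] _] e; case: h; rewrite e.
Qed.

End Walks.

Section Growth.

Variables (V : finType) (g : rel V).
Hypotheses (g_sym : symmetric g) (g_irr : irreflexive g).
Implicit Types (A C S : {set V}) (x y z : V) (k : nat).

Definition closed_nbhd S : {set V} := S :|: [set y | [exists x in S, g x y]].
Definition ball A k : {set V} := iter k closed_nbhd A.

Lemma ball_subS A k : ball A k \subset ball A k.+1.
Proof. exact: subsetUl. Qed.

Lemma ball_sub_rad A j k : j <= k -> ball A j \subset ball A k.
Proof.
elim: k => [|k IH]; first by rewrite leqn0 => /eqP->.
rewrite leq_eqVlt => /orP[/eqP->//|/IH h].
exact: subset_trans h (ball_subS _ _).
Qed.

Lemma ball_adj A k x y : x \in ball A k -> g x y -> y \in ball A k.+1.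
Proof. by move=> xA gxy; rewrite !inE; apply/orP; right; apply/exists_inP; exists x. Qed.

Lemma ball_mono A C k : A \subset C -> ball A k \subset ball C k.
Proof.
move=> /subsetP AC; elim: k => [|k IH]; first exact/subsetP.
apply/subsetP => y; rewrite !inE => /orP[/(subsetP IH) ->//|/exists_inP[x xA gxy]].
by apply/orP; right; apply/exists_inP; exists x => //; exact: (subsetP IH).
Qed.

Lemma ballD A j k : ball (ball A j) k = ball A (j + k).
Proof. by rewrite /ball -iterD addnC. Qed.

Lemma ballP A k y : reflect (exists2 x, x \in A & walk g x y k) (y \in ball A k).
Proof.
apply: (iffP idP).
  elim: k y => [|k IH] y; first by move=> yA; exists y => //; exact: walk0.
  rewrite !inE => /orP[/IH[x xA w]|/exists_inP[z /IH[x xA w] gzy]].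
    by exists x => //; apply: walk_mono w.
  by exists x => //; rewrite -addn1; apply: walk_trans w (walk1 gzy).
case=> x xA [p [pp lp sp]]; apply: (subsetP (ball_sub_rad A sp)) => {sp}.
elim/last_ind: p y pp lp => [|p z IH] y /=; first by move=> _ <-.
rewrite rcons_path last_rcons size_rcons => /andP[pp gz] <-.
exact: ball_adj (IH _ pp erefl) gz.
Qed.

Lemma ball_sym x y k : x \in ball [set y] k -> y \in ball [set x] k.
Proof.
case/ballP => z /set1P -> w; apply/ballP; exists x; rewrite ?inE //.
exact: walk_sym.
Qed.

(* [t] is a spanning forest of the [k]-ball around [C], one tree per element
   of [C], and [kap] sends a vertex to the root of its tree. *)
Lemma spanning_forest C k : exists (kap : V -> V) (t : {set V * V}),
  [/\ forall x y, (x, y) \in t -> [/\ g x y, (y, x) \in t, kap x = kap y & x \in ball C k],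
      #|t| + 2 * #|C| <= 2 * #|ball C k| &
      forall j x, j <= k -> x \in ball C j ->
        kap x \in C /\ walk [rel u v | (u, v) \in t] x (kap x) j].
Proof.
elim: k => [|k [kap [t [t1 t2 t3]]]].
  exists id, set0; split=> [x y||j x]; rewrite ?inE ?cards0 ?add0n //.
  by rewrite leqn0 => /eqP -> xC; split=> //; exact: walk0.
pose S := ball C k; pose X := ball C k.+1 :\: S.
pose par x := odflt x [pick z in S | g z x].
have parP x : x \in X -> par x \in S /\ g (par x) x.
  rewrite /par in_setD => /andP[xS].
  rewrite !inE (negbTE (xS : x \notin ball C k)) /= => /exists_inP[z zS gzx]; case: pickP => [z' /andP[]//|/(_ z)].
  by rewrite /= zS gzx.
pose kap' x := if x \in S then kap x else kap (par x).
pose t' := t :|: ([set (x, par x) | x in X] :|: [set (par x, x) | x in X]).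
have tt' x y : (x, y) \in t -> (x, y) \in t' by move=> h; rewrite inE h.
have XS x : x \in X -> x \in S = false by rewrite inE => /andP[/negbTE].
have SB x : x \in S -> x \in ball C k.+1 by apply/subsetP/ball_subS.
exists kap', t'; split=> [x y||j x jk xj].
- have new z : z \in X -> [/\ g z (par z), (z, par z) \in t', (par z, z) \in t',
      kap' z = kap' (par z) & z \in ball C k.+1 /\ par z \in ball C k.+1].
    move=> zX; have [pS gp] := parP z zX; split.
    + by rewrite g_sym.
    + by rewrite !inE; apply/orP; right; apply/orP; left; apply/imsetP; exists z.
    + by rewrite !inE; apply/orP; right; apply/orP; right; apply/imsetP; exists z.
    + by rewrite /kap' (XS z zX) pS.
    + by split; [move: zX; rewrite inE => /andP[]|exact: SB].
  case/setUP => [/t1[gxy tyx kxy xS]|/setUP[]/imsetP[z /new [g1 t4 t5 k1 [b1 b2]] [-> ->]]].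
  + have [_ _ _ yS] := t1 _ _ tyx.
    by split=> //; [exact: tt'|rewrite /kap' xS yS|exact: SB].
  + by [].
  + by split=> //; rewrite g_sym.
- have c1 : #|X| = #|ball C k.+1| - #|S| by rewrite cardsD (setIidPr (ball_subS _ _)).
  have c2 : #|S| <= #|ball C k.+1| by exact/subset_leq_card/ball_subS.
  have c3 : #|t'| <= #|t| + (#|X| + #|X|).
    rewrite /t' cardsU; apply: leq_trans (leq_subr _ _) _; rewrite leq_add2l.
    rewrite cardsU; apply: leq_trans (leq_subr _ _) _.
    by apply: leq_add; exact: leq_imset_card.
  move: t2; rewrite -/S; lia.
- have old i y : i <= k -> y \in ball C i ->
      kap' y \in C /\ walk [rel u v | (u, v) \in t'] y (kap' y) i.
    move=> ik yi; have yS : y \in S by exact: (subsetP (ball_sub_rad C ik)).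
    have [kC w] := t3 i y ik yi; rewrite /kap' yS; split=> //.
    by apply: walk_mono w => // u v; exact: tt'.
  move: jk xj; rewrite leq_eqVlt => /orP[/eqP->|jk xj]; last by apply: old.
  case: (boolP (x \in S)) => [xS _|xS xb].
    by have [kC w] := old k x (leqnn _) xS; split=> //; apply: walk_mono w.
  have xX : x \in X by rewrite inE xS xb.
  have [pS gp] := parP x xX; have [kC w] := old k _ (leqnn _) pS.
  have e : kap' x = kap' (par x) by rewrite /kap' pS (negbTE xS).
  rewrite e; split=> //; rewrite -add1n; apply: walk_trans w; apply: walk1.
  by rewrite /= !inE; apply/orP; right; apply/orP; left; apply/imsetP; exists x.
Qed.

Section ForestGirth.

Variables (L k : nat) (C : {set V}) (kap : V -> V) (t : {set V * V}).
Hypothesis gL : girth_gt g L.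
Hypothesis t1 : forall x y, (x, y) \in t -> [/\ g x y, (y, x) \in t, kap x = kap y & x \in ball C k].
Hypothesis t3 : forall j x, j <= k -> x \in ball C j ->
  kap x \in C /\ walk [rel u v | (u, v) \in t] x (kap x) j.

Let t_sym : symmetric [rel u v | (u, v) \in t].
Proof. by move=> x y /=; apply/idP/idP => /t1[]. Qed.

Let walk_root x y : x \in ball C k -> y \in ball C k -> kap x = kap y ->
  walk [rel u v | (u, v) \in t] x y (k + k).
Proof.
move=> xk yk e; have [_ wx] := t3 (leqnn _) xk; have [_ wy] := t3 (leqnn _) yk.
by apply: walk_trans wx _; rewrite e; apply: walk_sym.
Qed.

(** Inside one tree [x] and [y] are joined by a forest walk through the root, of length at most
    [k + k], and the extra edge would close a short cycle. *)
Lemma nonforest_root_neq x y : k + k < L -> x \in ball C k -> y \in ball C k ->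
  g x y -> (x, y) \notin t -> kap x != kap y.
Proof.
move=> kL xk yk gxy nt; apply/negP => /eqP e; move: kL; rewrite ltnNge => /negP[].
apply: (girth_detour (x := x) (y := y) gL) => //.
- by apply: contraTneq gxy => ->; rewrite g_irr.
- by rewrite g_sym.
apply: walk_mono (walk_root xk yk e) => // u v /= uv; have [-> _ _ _] := t1 uv.
by apply: contraNneq nt => -[<- <-].
Qed.

(** A second edge between the same two trees gives a detour around the first one: through one tree,
    across, and back through the other. *)
Lemma nonforest_inj x y x' y' : k + k + (k + k).+1 < L ->
  x \in ball C k -> y \in ball C k -> x' \in ball C k -> y' \in ball C k ->
  g x y -> g x' y' -> kap x != kap y -> kap x = kap x' -> kap y = kap y' ->
  (x, y) = (x', y').
Proof.
move=> kL xk yk xk' yk' gxy gxy' nk ex ey; apply/eqP; apply: contraT => ne.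
move: kL; rewrite ltnNge => /negP[].
apply: (girth_detour (x := x) (y := y) gL) => //.
- by apply: contraTneq gxy => ->; rewrite g_irr.
- by rewrite g_sym.
have tin u v : (u, v) \in t -> g u v && ((u, v) != (x, y)).
  move=> uv; have [-> _ kuv _] := t1 uv; apply: contraNneq nk => -[<- <-].
  by rewrite kuv.
apply: (walk_trans (y := x')); first exact: walk_mono (walk_root xk xk' ex).
rewrite -add1n; apply: (walk_trans (y := y')).
  by apply: walk1; rewrite /= gxy' eq_sym.
by apply: walk_mono (walk_root yk' yk (esym ey)).
Qed.

End ForestGirth.

End Growth.

Definition restrict (V : finType) (g : rel V) (H : {set V}) : rel V :=
  [rel x y | [&& x \in H, y \in H & g x y]].

(** Take [H] minimal among nonempty sets of this density. Removing [S] must break the density, so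
    many edges touch [S]. Edges are counted in both orientations. *)
Lemma dense_core (V : finType) (g : rel V) (a : nat) : 0 < #|V| ->
  2 * a.+1 * #|V| <= a * #|[set z : V * V | g z.1 z.2]| ->
  exists2 H : {set V}, H != set0 & forall S : {set V}, S \subset H ->
    2 * a.+1 * #|S| <= a *
      #|[set z : V * V | restrict g H z.1 z.2 && ((z.1 \in S) || (z.2 \in S))]|.
Proof.
move=> V0 dV.
pose e (H : {set V}) := #|[set z : V * V | restrict g H z.1 z.2]|.
pose P := [pred H : {set V} | (H != set0) && (2 * a.+1 * #|H| <= a * e H)].
have PT : P setT.
  rewrite /= -card_gt0 cardsT V0 /= (leq_trans dV) // leq_mul2l; apply/orP; right.
  by apply: subset_leq_card; apply/subsetP => z; rewrite /restrict !inE /= !inE.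
have [H /minsetP[/andP[H0 dH] Hmin] _] := minset_exists PT.
exists H => // S SH; set I := [set z | _].
have [->|S0] := eqVneq S set0; first by rewrite cards0 muln0.
have dec : e H <= #|I| + e (H :\: S).
  have [le _] := leq_card_setU I [set z : V * V | restrict g (H :\: S) z.1 z.2].
  apply: leq_trans le; apply: subset_leq_card.
  apply/subsetP => z; rewrite inE /= => /and3P[z1 z2 gz].
  rewrite in_setU !inE /restrict /= !inE z1 z2 gz /=.
  by case: (z.1 \in S); case: (z.2 \in S).
(* Minimality ranges over nonempty sets only; for [S = H] the bound is the density of [H]. *)
have [HS|HS] := eqVneq (H :\: S) set0.
  have SE : S = H by apply/eqP; rewrite eqEsubset SH -setD_eq0 HS eqxx.
  have e0 : e (H :\: S) = 0.
    by rewrite /e HS; apply: eq_card0 => z; rewrite !inE /restrict /= !inE.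
  rewrite e0 addn0 in dec; rewrite {1}SE; apply: leq_trans dH _.
  by rewrite leq_mul2l dec orbT.
have nP : a * e (H :\: S) < 2 * a.+1 * #|H :\: S|.
  rewrite ltnNge; apply/negP => dHS.
  have /setP E : H :\: S = H by apply: Hmin; [rewrite /= HS dHS|exact: subsetDl].
  have [x xS] := set0Pn _ S0.
  by move: (E x); rewrite inE xS (subsetP SH).
have cHS : #|H :\: S| + #|S| = #|H| by rewrite cardsD (setIidPr SH) subnK // subset_leq_card.
rewrite -cHS mulnDr in dH.
have := leq_mul (leqnn a) dec; rewrite mulnDr; lia.
Qed.

Section Clusters.

Variables (V : finType) (g : rel V) (H : {set V}) (a L : nat).
Hypotheses (g_sym : symmetric g) (g_irr : irreflexive g) (gL : girth_gt g L).
Hypotheses (a_gt0 : 0 < a) (H0 : H != set0).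
Hypothesis gH : forall x y, g x y -> y \in H.
Hypothesis Hdense : forall S : {set V}, S \subset H -> 2 * a.+1 * #|S| <= a *
  #|[set z : V * V | g z.1 z.2 && ((z.1 \in S) || (z.2 \in S))]|.

Lemma ball_core (A : {set V}) k : A \subset H -> ball g A k \subset H.
Proof.
move=> AH; elim: k => [|k IH] //=; apply/subsetP => y; rewrite !inE.
by case/orP => [/(subsetP IH)//|/exists_inP[x _ /gH]].
Qed.

(** All edges touching the [k]-ball lie in the next ball, which by girth induces a tree, with twice
    its size minus 2 oriented edges. The density of the [k]-ball does the rest. *)
Lemma ball_growth_step v k : v \in H -> k.+1 + k.+1 < L ->
  a.+1 * #|ball g [set v] k| + a <= a * #|ball g [set v] k.+1|.
Proof.
move=> vH kL; have [kap [t [t1 t2 t3]]] := spanning_forest g_sym [set v] k.+1.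
set B := ball g [set v] in t1 t2 t3 *.
have BH : B k \subset H by apply: ball_core; rewrite sub1set.
have Bt : [set z : V * V | g z.1 z.2 && ((z.1 \in B k) || (z.2 \in B k))] \subset t.
  apply/subsetP => -[x y]; rewrite inE /= => /andP[gxy xyB].
  have [xB yB] : x \in B k.+1 /\ y \in B k.+1.
    case/orP: xyB => h; have h' := subsetP (ball_subS g [set v] k) _ h; split=> //.
      exact: ball_adj h gxy.
    by apply: ball_adj h _; rewrite g_sym.
  apply: contraT => /(nonforest_root_neq g_sym g_irr gL t1 t3 kL xB yB gxy).
  have [/set1P-> _] := t3 _ _ (leqnn _) xB; have [/set1P-> _] := t3 _ _ (leqnn _) yB.
  by rewrite eqxx.
have := leq_trans (Hdense BH) (leq_mul (leqnn a) (subset_leq_card Bt)).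
rewrite cards1 in t2.
have := leq_mul (leqnn a) t2.
move: #|t| #|B k| #|B k.+1| => m1 m2 m3; rewrite mulnDr; nia.
Qed.

Lemma expn_succ_double : 2 * a ^ a <= a.+1 ^ a.
Proof.
case: a a_gt0 => // b _; have -> : b.+2 = b.+1 + 1 by rewrite addn1.
rewrite expnDn big_ord_recl big_ord_recl /= /bump /= bin0 bin1 subn0 subn1 /= !exp1n !muln1 mul1n -expnS.
by rewrite mul2n -addnn addnA leq_addr.
Qed.

(** Adding [a] to the ball size turns the affine recurrence into growth by the factor [1 + 1/a] per
    step, hence doubling every [a] steps. *)
Lemma ball_growth v i : v \in H -> a * i + a * i < L ->
  2 ^ i * a.+1 <= #|ball g [set v] (a * i)| + a.
Proof.
move=> vH; pose y k := #|ball g [set v] k| + a.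
have step k : k.+1 + k.+1 < L -> a.+1 * y k <= a * y k.+1.
  by move=> kL; have := ball_growth_step vH kL; rewrite /y; lia.
have steps k m : (k + m) + (k + m) < L -> a.+1 ^ m * y k <= a ^ m * y (k + m).
  elim: m => [|m IH] kL; first by rewrite addn0.
  have h1 := IH ltac:(lia); have h2 : a.+1 * y (k + m) <= a * y (k + m).+1 by apply: step; lia.
  rewrite addnS !expnS -!mulnA; apply: leq_trans (leq_mul (leqnn _) h1) _.
  by rewrite mulnCA [X in _ <= X]mulnCA leq_mul2l h2 orbT.
elim: i => [|i IH] iL; first by rewrite muln0 mul1n /= cards1 add1n.
have h1 := IH ltac:(lia).
have := steps (a * i) a; rewrite -mulnSr => /(_ iL) h2.
have : 2 * a ^ a * y (a * i) <= a ^ a * y (a * i.+1).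
  by apply: leq_trans h2; rewrite leq_mul2r expn_succ_double orbT.
rewrite [2 * _]mulnC -mulnA leq_pmul2l ?expn_gt0 ?a_gt0 // => h3.
by rewrite expnS -mulnA; apply: leq_trans h3; rewrite leq_mul2l.
Qed.

(** The centres [C] form a maximal set with pairwise disjoint [r]-balls, [r = a * i]. By maximality
    their [2r]-balls cover [H], and the trees of a spanning forest of radius [2r] are the cells. *)
Lemma cluster_minor i : 8 * (a * i) + 1 < L ->
  exists (C : {set V}) (kap : V -> V), [/\ C != set0,
    forall c, c \in C -> connected_in g [set x in H | kap x == c] &
    2 * 2 ^ i * #|C| <= #|[set z : V * V | [&& z.1 \in C, z.2 \in C, z.1 != z.2 &
      [exists x, exists y, [&& x \in H, y \in H, kap x == z.1, kap y == z.2 & g x y]]]]|].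
Proof.
move=> rL; set r := a * i in rL.
have kL1 : r + r + (r + r) < L by clear -rL; lia.
have kL2 : r + r + (r + r) + (r + r + (r + r)).+1 < L by clear -rL; lia.
pose P := [pred C : {set V} | (C \subset H) &&
  [forall x in C, forall y in C, (x != y) ==> [disjoint ball g [set x] r & ball g [set y] r]]].
have P0 : P set0.
  by rewrite /= sub0set; apply/forall_inP => x; rewrite inE.
have [C /maxsetP[/andP[CH /forall_inP Cdis] Cmax] _] := maxset_exists P0.
have Cdisj x y z : x \in C -> y \in C -> z \in ball g [set x] r -> z \in ball g [set y] r -> x = y.
  move=> xC yC zx zy; apply/eqP; apply: contraT => xy.
  have /forall_inP /(_ y yC) /implyP /(_ xy) /pred0P /(_ z) /= := Cdis _ xC.
  by rewrite zx zy.
have ballr x k : x \in ball g [set x] k.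
  by apply/ballP; exists x; [rewrite inE|exact: walk0].
have cover : ball g C (r + r) = H.
  apply/eqP; rewrite eqEsubset ball_core //=; apply/subsetP => x xH.
  have [[c [z [cC zx zc]]]|none] :
      (exists c z, [/\ c \in C, z \in ball g [set x] r & z \in ball g [set c] r]) \/
      (forall c z, c \in C -> z \in ball g [set x] r -> z \notin ball g [set c] r).
    case: (boolP [exists c in C, exists z, (z \in ball g [set x] r) && (z \in ball g [set c] r)]).
      by case/exists_inP => c cC /existsP[z /andP[zx zc]]; left; exists c, z.
    rewrite negb_exists_in => /forall_inP h; right => c z cC zx; apply/negP => zc.
    by have /negP := h c cC; apply; apply/existsP; exists z; rewrite zx.
  - rewrite -ballD; apply: (subsetP (ball_mono _ _ (A := [set z]) _)); last exact: ball_sym.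
    by rewrite sub1set; apply: (subsetP (ball_mono _ _ (A := [set c]) _)); rewrite ?sub1set.
  - have xC : x |: C = C.
      apply: Cmax; last exact: subsetUr.
      rewrite /= subUset sub1set xH CH /=.
      apply/forall_inP => u /setU1P[->|uC]; apply/forall_inP => w /setU1P[->|wC]; apply/implyP => uw.
      + by rewrite eqxx in uw.
      + by apply/pred0P => z /=; apply/negP => /andP[zx zw]; have := none w z wC zx; rewrite zw.
      + by apply/pred0P => z /=; apply/negP => /andP[zw zx]; have := none u z uC zx; rewrite zw.
      + by have /forall_inP /(_ w wC) /implyP := Cdis _ uC; apply.
    by apply: (subsetP (ball_sub_rad g C (leq0n _))); rewrite /= -xC !inE eqxx.
have [kap [t [t1 t2 t3]]] := spanning_forest g_sym C (r + r).
have inB x : (x \in ball g C (r + r)) = (x \in H) by rewrite cover.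
have kC x : x \in H -> kap x \in C by rewrite -inB => /(t3 _ _ (leqnn _))[].
(* A vertex at distance at most [r] from [C] is within [r] of its own root, so disjointness of the
   [r]-balls leaves no choice of root. *)
have kball c x : c \in C -> x \in ball g [set c] r -> kap x = c.
  move=> cC xc; have xr : x \in ball g C r by apply: (subsetP (ball_mono _ _ _)) xc; rewrite sub1set.
  have [kc w] := t3 r x (leq_addr _ _) xr.
  apply: Cdisj kc cC _ xc; apply: ball_sym => //.
  by apply/ballP; exists x; rewrite ?inE //; apply: walk_mono w => // u v /t1[].
have C0 : C != set0.
  by have [x xH] := set0Pn _ H0; apply/set0Pn; exists (kap x); exact: kC.
exists C, kap; split=> // [c cC|].
  pose Bc := [set x in H | kap x == c].
  have cB : c \in Bc by rewrite inE (subsetP CH) // (kball c c) ?eqxx.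
  split; first by apply/set0Pn; exists c.
  set s := [rel u v | _].
  have ssym : symmetric s by move=> u v; rewrite /s /= g_sym andbCA.
  have toc x : x \in Bc -> connect s x c.
    rewrite inE => /andP[xH /eqP kx].
    have [_ [p [pp lp _]]] := t3 _ x (leqnn _) (etrans (inB x) xH).
    rewrite kx in lp; apply/connectP; exists p => //.
    elim: p x xH kx pp lp => //= y p IH x xH kx /andP[xy pp] lp.
    have [gxy tyx kxy _] := t1 _ _ xy; have yH := gH gxy.
    by rewrite !inE xH yH kx -kxy kx eqxx gxy /=; apply: IH; rewrite // -kxy.
  move=> x y xB yB; apply: connect_trans (toc x xB) _.
  by rewrite (sym_connect_sym ssym) toc.
(* Edges off the forest join distinct cells, and distinct edges join distinct pairs of cells. *)
pose N := [set z : V * V | g z.1 z.2] :\: t.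
pose f (z : V * V) := (kap z.1, kap z.2).
have NP x y : (x, y) \in N -> [/\ x \in H, y \in H, g x y & kap x != kap y].
  rewrite !inE /= => /andP[nt gxy]; have yH := gH gxy.
  have xH : x \in H by apply: (@gH y); rewrite g_sym.
  split=> //; apply: (nonforest_root_neq g_sym g_irr gL t1 t3) => //; rewrite ?inB //.
have finj : {in N &, injective f}.
  move=> [x y] [x' y'] /NP[xH yH gxy kxy] /NP[xH' yH' gxy' _] [e1 e2].
  by apply: (nonforest_inj g_sym g_irr gL t1 t3); rewrite ?inB //.
apply: (@leq_trans #|N|); last first.
  rewrite -(card_in_imset finj); apply: subset_leq_card; apply/subsetP => z /imsetP[[x y] /NP[xH yH gxy kxy] ->].
  rewrite inE /= !kC // kxy /=; apply/existsP; exists x; apply/existsP; exists y.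
  by rewrite xH yH !eqxx.
have cN : #|[set z : V * V | g z.1 z.2]| <= #|N| + #|t|.
  rewrite /N cardsD; have := subset_leq_card (subsetIr [set z : V * V | g z.1 z.2] t).
  by move: #|_| #|_| #|_| => x y z; lia.
have dE : 2 * a.+1 * #|H| <= a * #|[set z : V * V | g z.1 z.2]|.
  apply: leq_trans (Hdense (subxx H)) _; rewrite leq_mul2l; apply/orP; right.
  by apply: subset_leq_card; apply/subsetP => z; rewrite !inE => /andP[].
have cH : #|C| * (2 ^ i * a.+1 - a) <= #|H|.
  rewrite -[X in _ <= X]sum1_card (partition_big kap (mem C)) //= -sum_nat_const.
  apply: leq_sum => c cC; have := ball_growth (subsetP CH _ cC) (i := i) ltac:(rewrite -/r; clear -rL; lia).
  rewrite -/r -leq_subLR leq_subLR addnC -leq_subLR => h; apply: leq_trans h _.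
  rewrite -sum1_card; apply: (@leq_trans #|[set x in H | kap x == c]|); last first.
    by rewrite -sum1_card; apply: eq_leq; apply: eq_bigl => x; rewrite inE.
  rewrite sum1_card; apply: subset_leq_card; apply/subsetP => x xc.
  by rewrite inE (kball c x) // eqxx (subsetP (@ball_core [set c] r _)) // sub1set (subsetP CH).
rewrite cover in t2.
have p1 : 0 < 2 ^ i by rewrite expn_gt0.
have cH' : #|C| * (2 ^ i * a.+1) <= #|H| + #|C| * a.
  by move: cH; rewrite mulnBr leq_subLR addnC.
(* Density minus forest size gives [a * #|N| >= 2 * #|H| + 2 * a * #|C|], and by [cH'] this is at
   least [2 * a.+1 * 2 ^ i * #|C|]. *)
rewrite -(leq_pmul2l a_gt0).
have := leq_mul (leqnn a) cN; rewrite mulnDr.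
have := leq_mul (leqnn a) t2; rewrite mulnDr.
set X := a * #|[set z : V * V | g z.1 z.2]| in dE *.
move: (2 ^ i) p1 cH' => D; nia.
Qed.

End Clusters.

(** * Clique minors of dense minor models *)

(** Fix [x]. The elements not good with [x] are pairwise good, so [t] of them suffice; otherwise at
    most [t] elements, [x] included, are discarded, and the recursion runs among those good with
    [x]. *)
Lemma ramsey3 (T : finType) (good : rel T) (t k : nat) (S : {set T}) :
  symmetric good -> 0 < t ->
  {in S & &, forall x y z, x != y -> y != z -> x != z -> [|| good x y, good y z | good x z]} ->
  k * t <= #|S| ->
  exists2 Q : {set T}, Q \subset S & ((k <= #|Q|) || (t <= #|Q|)) /\
    {in Q &, forall x y, x != y -> good x y}.
Proof.
move=> gs t0; elim: k S => [|k IH] S S3 kS.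
  by exists set0; rewrite ?sub0set ?cards0 //; split=> // x y; rewrite inE.
have /card_gt0P[x xS] : 0 < #|S| by apply: leq_trans kS; rewrite mulSn addn_gt0 t0.
pose X := [set y in S | (y != x) && ~~ good x y].
pose Y := [set y in S | (y != x) && good x y].
have XS : X \subset S by apply/subsetP => y; rewrite inE => /andP[].
have YS : Y \subset S by apply/subsetP => y; rewrite inE => /andP[].
have [tX|Xt] := leqP t #|X|.
  exists X => //; rewrite tX orbT; split=> // y z.
  rewrite !inE => /and3P[yS yx ny] /and3P[zS zx nz] yz.
  have := S3 y z x yS zS xS yz zx yx.
  by rewrite [good z x]gs [good y x]gs (negbTE ny) (negbTE nz) !orbF.
have cS : #|S| <= 1 + #|X| + #|Y|.
  apply: (@leq_trans #|x |: X :|: Y|).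
    apply: subset_leq_card; apply/subsetP => y yS; rewrite !inE yS.
    by case: eqP => //= _; case: (good x y); rewrite ?orbT.
  apply: leq_trans (leq_card_setU _ _).1 _; rewrite leq_add2r.
  by rewrite cardsU1; case: (_ \notin _); rewrite ?leq_addl.
have Y3 : {in Y & &, forall x y z, x != y -> y != z -> x != z ->
    [|| good x y, good y z | good x z]}.
  by move=> y z w yY zY wY; apply: S3; apply: (subsetP YS).
have kY : k * t <= #|Y| by move: kS; rewrite mulSn; lia.
have [Q QY [Qc Qg]] := IH Y Y3 kY.
have Qx y : y \in Q -> [/\ y \in S, y != x & good x y].
  by move=> /(subsetP QY); rewrite inE => /and3P[].
exists (x |: Q).
  by rewrite subUset sub1set xS (subset_trans QY).
have xQ : x \notin Q by apply/negP => /Qx[]; rewrite eqxx.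
split; first by rewrite cardsU1 xQ add1n ltnS; case/orP: Qc => [->//|h]; rewrite (leq_trans h) ?orbT.
move=> y z /setU1P[->|yQ] /setU1P[->|zQ]; rewrite ?eqxx // => ne; last exact: Qg.
- by have [] := Qx z zQ.
- by rewrite gs; have [] := Qx y yQ.
Qed.

(** Greedy choice works: fewer than [#|P|] representatives are taken when the next one is picked. *)
Lemma distinct_representatives (P W : finType) (X : P -> {set W}) :
  (forall p, #|P| <= #|X p|) ->
  exists2 f : P -> W, injective f & forall p, f p \in X p.
Proof.
move=> cX.
have [e0|] := eqVneq #|P| 0.
  have noP (p : P) : False by have := fintype0 p.
  by exists (fun p => False_rect _ (noP p)) => p; case: (noP p).
rewrite -lt0n => /card_gt0P[p0 _]; have /card_gt0P[w0 _] : 0 < #|X p0|.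
  by apply: leq_trans (cX p0); apply/card_gt0P; exists p0.
suff [f finj fX] : exists2 f : P -> W,
    {in enum P &, injective f} & forall p, p \in enum P -> f p \in X p.
  by exists f => [p p' e|p]; [apply: finj; rewrite ?mem_enum|apply: fX; rewrite mem_enum].
have: uniq (enum P) by exact: enum_uniq.
elim: (enum P) => [|p s IH] /=; first by exists (fun=> w0).
move=> /andP[ps us]; have [f finj fX] := IH us.
have /subsetPn[w wX wf] : ~~ (X p \subset [set f p' | p' in s]).
  apply/negP => /subset_leq_card; apply/negP; rewrite -ltnNge.
  apply: leq_trans (cX p); apply: leq_ltn_trans (leq_imset_card _ _) _.
  rewrite (card_uniqP us); have <- : #|p :: s| = (size s).+1 by apply/card_uniqP; rewrite /= ps us.
  exact: max_card.
have wf' p' : p' \in s -> f p' != w.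
  by move=> ps'; apply: contraNneq wf => <-; apply: imset_f.
exists (fun p' => if p' == p then w else f p') => [p1 p2|p1].
  rewrite !inE; case: eqP => [->|_] /=; case: eqP => [->|_] //= h1 h2 e.
  - by move: (wf' _ h2); rewrite -e eqxx.
  - by move: (wf' _ h1); rewrite e eqxx.
  - exact: finj.
by rewrite inE; case: eqP => [->|_] //= h; exact: fX.
Qed.

Section MinorModels.

Variables (V W : finType) (g : rel V).
Hypothesis g_sym : symmetric g.
Implicit Types (C Z : {set W}) (B : W -> {set V}).

Definition touch B : rel W :=
  [rel x y | (x != y) && [exists u in B x, exists v in B y, g u v]].

Definition minor_model C B : Prop :=
  {in C &, forall x y, x != y -> [disjoint B x & B y]} /\
  {in C, forall x, connected_in g (B x)}.

Definition deg C B x : nat := \sum_(y in C) touch B x y.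

Definition edges2 C B : nat := \sum_(x in C) deg C B x.

Definition common C B x y : {set W} := [set z in C | touch B x z && touch B y z].

Lemma touchP B x y :
  reflect (x != y /\ exists u v, [/\ u \in B x, v \in B y & g u v]) (touch B x y).
Proof.
apply: (iffP andP) => [[xy /exists_inP[u uB /exists_inP[v vB guv]]]|[xy [u [v [uB vB guv]]]]].
  by split=> //; exists u, v.
by split=> //; apply/exists_inP; exists u => //; apply/exists_inP; exists v.
Qed.

Lemma touch_sym B : symmetric (touch B).
Proof.
move=> x y; apply/touchP/touchP => -[xy [u [v [uB vB guv]]]];
  by rewrite eq_sym; split=> //; exists v, u; rewrite g_sym.
Qed.

Lemma touch_irr B : irreflexive (touch B).
Proof. by move=> x; rewrite /touch /= eqxx. Qed.

Lemma degE C B x : deg C B x = #|[set y in C | touch B x y]|.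
Proof.
rewrite -sum1_card /deg big_mkcond [RHS]big_mkcond; apply: eq_bigr => y _.
by rewrite !inE; case: (y \in C) => //=; case: (touch B x y).
Qed.

Lemma edges2D1 C B x : x \in C -> edges2 C B = edges2 (C :\ x) B + 2 * deg (C :\ x) B x.
Proof.
move=> xC; rewrite /edges2 /deg (big_setD1 x) //= (big_setD1 x) //= touch_irr add0n.
have -> : \sum_(y in C :\ x) \sum_(z in C) touch B y z =
    \sum_(y in C :\ x) (touch B x y + \sum_(z in C :\ x) touch B y z).
  by apply: eq_bigr => y _; rewrite (big_setD1 x) //= touch_sym.
by rewrite big_split /= mul2n -addnn addnA addnC.
Qed.

Lemma deg_setD1 C B x : x \in C -> deg (C :\ x) B x = deg C B x.
Proof. by move=> xC; rewrite [RHS]/deg (big_setD1 x) //= touch_irr. Qed.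

Lemma connected_star B Z c : c \in Z ->
  {in Z, forall z, connected_in g (B z)} ->
  {in Z, forall z, z = c \/ touch B c z} ->
  connected_in g (\bigcup_(z in Z) B z).
Proof.
move=> cZ Bcon Bc; set U := \bigcup_(z in Z) B z.
have BU z : z \in Z -> B z \subset U by move=> zZ; exact: bigcup_sup.
split.
  have /set0Pn[u uc] := (Bcon c cZ).1; apply/set0Pn; exists u.
  by apply/bigcupP; exists c.
set s := [rel u v | _].
have ssym : symmetric s by move=> u v; rewrite /s /= g_sym andbCA.
have inz z u v : z \in Z -> u \in B z -> v \in B z -> connect s u v.
  move=> zZ uz vz; apply: connect_sub ((Bcon z zZ).2 _ _ uz vz) => a b /and3P[az bz gab].
  by apply: connect1; rewrite /s /= gab !(subsetP (BU z zZ)).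
have toc u v : v \in B c -> u \in U -> connect s u v.
  move=> vc /bigcupP[z zZ uz]; case: (Bc z zZ) => [e|/touchP[_ [a [b [ac bz gab]]]]].
    by rewrite e in uz; exact: (inz c).
  apply: connect_trans (inz z u b zZ uz bz) _; apply: connect_trans (inz c a v cZ ac vc).
  by apply: connect1; rewrite /s /= g_sym gab (subsetP (BU z zZ)) ?(subsetP (BU c cZ)).
have /set0Pn[w wc] := (Bcon c cZ).1.
move=> u v uU vU; apply: connect_trans (toc u w wc uU) _.
by rewrite (sym_connect_sym ssym) toc.
Qed.

Definition merge B x y := fun z => if z == x then B x :|: B y else B z.

Lemma merge_model C B x y : minor_model C B -> x \in C -> y \in C -> touch B x y ->
  minor_model (C :\ y) (merge B x y).
Proof.
move=> [Bd Bc] xC yC txy; split.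
  have key z : z \in C -> z != x -> z != y -> [disjoint B x :|: B y & B z].
    by move=> zC zx zy; rewrite -setI_eq0 setIUl setU_eq0 !setI_eq0 !Bd // eq_sym.
  move=> z1 z2; rewrite !inE /merge => /andP[z1y z1C] /andP[z2y z2C] ne.
  case: eqP => [e1|/eqP n1]; case: eqP => [e2|/eqP n2].
  - by rewrite e1 e2 eqxx in ne.
  - exact: key.
  - by rewrite disjoint_sym; exact: key.
  - exact: Bd.
move=> z; rewrite !inE /merge => /andP[zy zC]; case: eqP => [_|_]; last exact: Bc.
have -> : B x :|: B y = \bigcup_(z in [set x; y]) B z.
  by rewrite big_setU1 /= ?big_set1 // inE; case/touchP: txy.
apply: (connected_star (c := x)); first by rewrite !inE eqxx.
  by move=> w /set2P[->|->]; exact: Bc.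
by move=> w /set2P[->|->]; [left|right].
Qed.

(** Contraction loses the edge between [x] and [y] and one edge per common neighbour; everything
    counts twice. *)
Lemma edges2_merge C B x y : x \in C -> y \in C -> touch B x y ->
  edges2 C B <= edges2 (C :\ y) (merge B x y) + 2 + 2 * #|common C B x y|.
Proof.
move=> xC yC txy; have xy : x != y by case/touchP: txy.
have xCy : x \in C :\ y by rewrite !inE xy.
rewrite (edges2D1 B yC) (edges2D1 B xCy) (edges2D1 (merge B x y) xCy).
set C0 := C :\ y :\ x.
have C0x z : z \in C0 -> [/\ z != x, z != y & z \in C] by rewrite !inE => /and3P[].
have mE z : z \in C0 -> merge B x y z = B z.
  by move=> /C0x[zx _ _]; rewrite /merge (negbTE zx).
have e0 : edges2 C0 (merge B x y) = edges2 C0 B.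
  apply: eq_bigr => z zC; apply: eq_bigr => w wC; rewrite /touch /=.
  by rewrite !mE.
have tm z : z \in C0 -> touch (merge B x y) x z = touch B x z || touch B y z.
  move=> zC; have [zx zy _] := C0x z zC; apply/touchP/orP.
    move=> [_ [u [v [+ + guv]]]]; rewrite (mE z zC) /merge eqxx => /setUP[] uB vB.
      by left; apply/touchP; split; [rewrite eq_sym|exists u, v].
    by right; apply/touchP; split; [rewrite eq_sym|exists u, v].
  by case=> /touchP[ne [u [v [uB vB guv]]]]; (split; first by rewrite eq_sym);
    exists u, v; rewrite (mE z zC) /merge eqxx inE uB ?orbT.
have e1 : deg (C :\ y) B y = 1 + deg C0 B y.
  by rewrite /deg (big_setD1 x) //= touch_sym txy.
have e2 : deg C0 B x + deg C0 B y <= deg C0 (merge B x y) x + #|common C B x y|.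
  have : \sum_(z in C0) (touch B x z && touch B y z : nat) <= #|common C B x y|.
    rewrite -sum1_card big_mkcond [X in _ <= X]big_mkcond; apply: leq_sum => z _.
    rewrite [z \in common _ _ _ _]inE; case: ifP => // /C0x[_ _ ->] /=.
    by case: (_ && _).
  move=> le; apply: leq_trans (leq_add (leqnn _) le).
  rewrite /deg -!big_split /=; apply: leq_sum => z zC; rewrite tm //.
  by case: (touch B x z); case: (touch B y z).
rewrite e0 e1; move: e2; clear; lia.
Qed.

(** In a dense model with the fewest branch sets, deleting one shows that every degree exceeds [D],
    and contracting an edge shows that its ends have [D] common neighbours. Deletion also keeps the
    edge count barely above the threshold, which bounds the minimum degree. *)
Lemma minimal_dense_model C B D : 0 < D -> minor_model C B -> C != set0 ->
  2 * D * #|C| <= edges2 C B ->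
  exists C' B', [/\ minor_model C' B',
    exists2 v, v \in C' & D < deg C' B' v <= 2 * D + 2 &
    {in C' &, forall x y, touch B' x y -> D <= #|common C' B' x y|}].
Proof.
move=> D0; have [m] := ubnP #|C|; elim: m C B => // m IH C B Cm BM C0 dC.
pose smaller := exists C' B', [/\ #|C'| < #|C|, minor_model C' B', C' != set0 &
  2 * D * #|C'| <= edges2 C' B'].
have [[C' [B' [cC BM' C0' dC']]]|nsm] := pselect smaller.
  by apply: (IH C' B') => //; apply: leq_trans cC _.
have small C' B' : #|C'| < #|C| -> minor_model C' B' -> C' != set0 ->
    edges2 C' B' < 2 * D * #|C'|.
  move=> cC BM' C0'; rewrite ltnNge; apply/negP => dC'.
  by apply: nsm; exists C', B'.
have cC1 x : x \in C -> #|C| = (#|C :\ x|).+1 by move=> xC; rewrite (cardsD1 x) xC.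
have CD1 x : x \in C -> C :\ x != set0.
  move=> xC; apply/negP => /eqP e.
  have := edges2D1 B xC; rewrite e /edges2 /deg !big_set0 muln0 addn0 => e0.
  by move: dC; rewrite /edges2 e0 leqn0 (cC1 x xC) !muln_eq0 /= eqn0Ngt D0.
have degD x : x \in C -> edges2 C B < 2 * D * #|C :\ x| + 2 * deg C B x.
  move=> xC; rewrite (edges2D1 B xC) deg_setD1 // ltn_add2r; apply: small => //.
  - by rewrite [X in _ < X](cC1 x).
  - case: BM => Bd Bc; split=> [y z|y]; rewrite !inE.
      by move=> /andP[_ yC] /andP[_ zC]; exact: Bd.
    by case/andP=> _; exact: Bc.
  - exact: CD1.
have Dlt x : x \in C -> D < deg C B x.
  by move=> xC; have := degD x xC; move: dC; rewrite (cC1 x xC) mulnS; lia.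
exists C, B; split=> // [|x y xC yC txy].
- have [c cC] := set0Pn _ C0.
  pose v := [arg min_(x < c in C) deg C B x].
  have [vC vmin] : v \in C /\ forall x, x \in C -> deg C B v <= deg C B x.
    by rewrite /v; case: arg_minnP => // x xC h; split.
  exists v; rewrite ?Dlt //=.
  have ub : #|C| * deg C B v <= edges2 C B.
    by rewrite -sum_nat_const; apply: leq_sum => x; exact: vmin.
  have vC1 : deg C B v <= #|C :\ v|.
    rewrite -deg_setD1 // /deg -sum1_card; apply: leq_sum => z _.
    by case: (touch B v z).
  have := degD v vC; move: ub vC1; rewrite (cC1 v vC).
  move: (deg C B v) #|C :\ v| (edges2 C B) => d c1 e h1 h2 h3; rewrite leqNgt; apply/negP => h4.
  have h5 : c1.+1 * d < 2 * D * c1 + 2 * d by exact: leq_ltn_trans h1 h3.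
  clear -h5 h2 h4; nia.
- have xy : x != y by case/touchP: txy.
  have h1 : edges2 (C :\ y) (merge B x y) < 2 * D * #|C :\ y|.
    apply: small; first by rewrite [X in _ < X](cC1 y).
      exact: merge_model.
    exact: CD1.
  have := edges2_merge xC yC txy; move: dC h1; rewrite (cC1 y yC) mulnS.
  move: (2 * D * _) (edges2 C B) (edges2 _ _) #|common C B x y| => a b e f.
  by clear; lia.
Qed.

Lemma dense_model_clique_minor C B t : 0 < t -> minor_model C B -> C != set0 ->
  2 * (3 * (t * t + t)) * #|C| <= edges2 C B -> has_clique_minor g t.
Proof.
set D := 3 * _ => t0 BM0 C0 dC0.
have D0 : 0 < D by rewrite /D; lia.
have {C B BM0 C0 dC0}[C [B [[Bd Bc] [v vC vdeg] com]]] := minimal_dense_model D0 BM0 C0 dC0.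
pose N := [set y in C | touch B v y].
have NE : #|N| = deg C B v by rewrite degE.
pose M u := [set z in N | touch B u z].
have ME u : u \in N -> D <= #|M u|.
  rewrite inE => /andP[uC tvu]; apply: leq_trans (com v u vC uC tvu) _.
  by apply: subset_leq_card; apply/subsetP => z; rewrite !inE => /and3P[-> -> ->].
pose good u w := t * t + t <= #|M u :&: M w|.
have [] := @ramsey3 _ good t t N.
- by move=> u w; rewrite /good setIC.
- exact: t0.
(* If all three intersections had fewer than [t * t + t] elements, inclusion-exclusion inside [N]
   would give [3 * D <= 2 * D + 2 + 3 * (t * t + t - 1) = 3 * D - 1]. *)
- move=> x y z /ME cx /ME cy /ME cz _ _ _; rewrite /good.
  have h1 := cardsUI (M x) (M y); have h2 := cardsUI (M x :|: M y) (M z).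
  have h3 : #|M x :|: M y :|: M z| <= #|N|.
    by apply: subset_leq_card; apply/subsetP => w; rewrite !inE => /orP[/orP[]|] /andP[].
  have h4 : #|(M x :|: M y) :&: M z| <= #|M x :&: M z| + #|M y :&: M z|.
    rewrite setIUl cardsU; exact: leq_subr.
  case/andP: vdeg => _; rewrite -NE.
  move: #|N| #|M x :|: M y| #|M x :|: M y :|: M z| #|M x :&: M y| #|M y :&: M z| #|M x :&: M z| h1 h2 h3 h4 cx cy cz.
  move: #|(_ :|: _) :&: _| #|M x| #|M y| #|M z|; rewrite /D; move: (t * t + t); clear; lia.
- by rewrite NE; case/andP: vdeg => h _; apply: leq_trans (ltnW h); rewrite /D; lia.
move=> Q QN [Qt Qg]; rewrite orbb in Qt.
pose h (i : 'I_t) := nth v (enum Q) i.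
have hQ i : h i \in Q by rewrite -mem_enum mem_nth // -cardE (leq_trans (ltn_ord i)).
have hinj : injective h.
  move=> i j /eqP; rewrite nth_uniq ?enum_uniq -?cardE ?(leq_trans (ltn_ord _)) //.
  by move=> /eqP/val_inj.
have hN i : h i \in N by apply: (subsetP QN).
pose hubs := [set h i | i in 'I_t].
(* Removing at most [t] hubs leaves [t * t] candidates, enough for distinct connectors for all
   ordered pairs, diagonal ones included. *)
pose X (p : 'I_t * 'I_t) := (M (h p.1) :&: M (h p.2)) :\: hubs.
have cX p : #|{: 'I_t * 'I_t}| <= #|X p|.
  rewrite card_prod card_ord /X cardsD.
  have ch : #|M (h p.1) :&: M (h p.2) :&: hubs| <= t.
    apply: leq_trans (subset_leq_card (subsetIr _ _)) _.
    by apply: leq_trans (leq_imset_card _ _) _; rewrite card_ord.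
  suff : t * t + t <= #|M (h p.1) :&: M (h p.2)| by move: ch; clear; lia.
  have [e|ne] := eqVneq (h p.1) (h p.2); last exact: (Qg _ _ (hQ _) (hQ _) ne).
  by rewrite e setIid; apply: leq_trans (ME _ (hN p.2)); rewrite /D; clear; lia.
have [con coninj conX] := distinct_representatives cX.
have conP i j : [/\ con (i, j) \in C, touch B (h i) (con (i, j)), touch B (h j) (con (i, j)) & con (i, j) \notin hubs].
  have := conX (i, j); rewrite in_setD in_setI => /andP[ch /andP[]] /=.
  by move=> /setIdP[/setIdP[cC _] t1] /setIdP[_ t2].
have hC i : h i \in C by have := hN i; rewrite inE => /andP[].
(* The connector of a pair joins the branch set of the smaller index and touches the hub of the
   larger one. *)
pose Z i := h i |: [set con (i, j) | j : 'I_t & i < j].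
have ZC i z : z \in Z i -> z \in C.
  by case/setU1P => [->|/imsetP[j _ ->]]; rewrite ?hC //; have [] := conP i j.
have Zdis i j z : z \in Z i -> z \in Z j -> i = j.
  have hub k : h k \in hubs by apply: imset_f.
  case/setU1P => [->|/imsetP[a _ ->]] /setU1P[|/imsetP[b _]].
  - exact: hinj.
  - by move=> e; have [_ _ _] := conP j b; rewrite -e hub.
  - by move=> e; have [_ _ _] := conP i a; rewrite e hub.
  - by move/coninj => [].
exists (fun i => \bigcup_(z in Z i) B z); split=> [i j ij|i|i j ij].
- apply/pred0P => u /=; apply/negP => /andP[/bigcupP[z zi uz] /bigcupP[w wj uw]].
  have zw : z != w by apply: contraNneq ij => e; rewrite -e in wj; rewrite (Zdis _ _ _ zi wj).
  have /pred0P /(_ u) /= := Bd _ _ (ZC _ _ zi) (ZC _ _ wj) zw.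
  by rewrite uz uw.
- apply: (connected_star (c := h i)); first by rewrite !inE eqxx.
    by move=> z /ZC; exact: Bc.
  move=> z /setU1P[->|/imsetP[j _ ->]]; [by left|right].
  by have [] := conP i j.
- have [_ _ /touchP[_ [u [w [uh wc guw]]]] _] := conP i j.
  exists w, u; split; last by rewrite g_sym.
    apply/bigcupP; exists (con (i, j)) => //; apply/setU1P; right.
    by apply/imsetP; exists j; rewrite // inE.
  by apply/bigcupP; exists (h j) => //; apply/setU1P; left.
Qed.

End MinorModels.

Lemma clique_minor_sub (V : finType) (g g' : rel V) t :
  (forall x y, g x y -> g' x y) -> has_clique_minor g t -> has_clique_minor g' t.
Proof.
move=> gg [B [Bd Bc Be]]; exists B; split=> // [i|i j ij].
  have [B0 Bcon] := Bc i; split=> // x y xB yB.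
  apply: connect_sub (Bcon x y xB yB) => u v /and3P[uB vB guv].
  by apply: connect1; rewrite /= uB vB gg.
by have [x [y [xB yB gxy]]] := Be i j ij; exists x, y; split=> //; exact: gg.
Qed.

Theorem girth_dense_clique_minor (V : finType) (g : rel V) a i t L :
  symmetric g -> irreflexive g -> 0 < t -> 0 < a -> 0 < #|V| -> girth_gt g L ->
  8 * (a * i) + 1 < L -> 3 * (t * t + t) <= 2 ^ i ->
  2 * a.+1 * #|V| <= a * #|[set z : V * V | g z.1 z.2]| ->
  has_clique_minor g t.
Proof.
move=> gs gi t0 a0 V0 gL iL ti dV.
have [H H0 Hd] := dense_core V0 dV; pose r := restrict g H.
have rs : symmetric r by move=> x y; rewrite /r /restrict /= gs andbCA.
have ri : irreflexive r by move=> x; rewrite /r /restrict /= gi !andbF.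
have rg x y : r x y -> g x y by case/and3P.
have rL : girth_gt r L.
  move=> c /andP[cc uc]; apply: gL; rewrite /ucycle uc andbT.
  by case: c cc {uc} => //= x c; apply: sub_path.
have rH x y : r x y -> y \in H by case/and3P.
have [C [kap [C0 Bc cE]]] := cluster_minor rs ri rL a0 H0 rH Hd iL.
pose B c := [set x in H | kap x == c].
apply: clique_minor_sub rg _; apply: (dense_model_clique_minor rs t0 (C := C) (B := B)) => //.
  split=> // x y _ _ xy; apply/pred0P => u /=; rewrite !inE.
  by apply/negP => /andP[/andP[_ /eqP ->] /andP[_ /eqP e]]; rewrite e eqxx in xy.
apply: leq_trans (leq_trans _ cE) _; first by rewrite leq_mul2r leq_mul2l ti !orbT.
rewrite /edges2 /deg pair_big_dep /= -sum1_card big_mkcond [X in _ <= X]big_mkcond /=.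
apply: leq_sum => -[x y] _; rewrite inE /=.
case: ifP => // /and4P[-> -> xy /existsP[u /existsP[v /and5P[uH vH ku kv guv]]]] /=.
rewrite (_ : touch r B x y) //; apply/touchP; split=> //; exists u, v.
by rewrite !inE uH vH ku kv.
Qed.

Lemma card_edge_adj n (K : {set {set 'I_n}}) : K \subset complete_edges n ->
  2 * #|K| <= #|[set z : 'I_n * 'I_n | edge_adj K z.1 z.2]|.
Proof.
move=> /subsetP Kc; rewrite -[X in _ <= X]sum1_card.
rewrite (partition_big (fun z : 'I_n * 'I_n => [set z.1; z.2]) (mem K)) /=; last first.
  by move=> z; rewrite inE => /andP[].
rewrite mulnC -sum_nat_const; apply: leq_sum => e eK.
have := Kc e eK; rewrite inE => /cards2P[x [y [xy exy]]].
rewrite (bigD1 (x, y)) /=; last by rewrite inE /edge_adj /= xy -exy eK eqxx.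
rewrite (bigD1 (y, x)) //= inE /edge_adj /= eq_sym xy setUC -exy eK eqxx /=.
by apply/eqP => -[e1 _]; rewrite e1 eqxx in xy.
Qed.

(** The last hypothesis is the density requirement multiplied by [Q], with the loss [4 ^ L.+1] to
    short cycles for [L = 8 * (a * i) + 2]. *)
Theorem client_builds_clique_minor n q Q a i t :
  1 < n -> q < Q -> n <= 4 * Q -> 0 < a -> 0 < t -> 3 * (t * t + t) <= 2 ^ i ->
  a.+1 * n * Q + a * Q * 4 ^ (8 * (a * i) + 3) <= a * 'C(n, 2) ->
  client_can_build q (complete_edges n) (fun E => has_clique_minor (edge_adj E) t).
Proof.
move=> n1 qQ nQ a0 t0 ti num.
have [s vs Hs] := client_builds_high_girth (8 * (a * i)).+2 n1 qQ nQ.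
exists s => // h lh go fh; have [K [KE Kc gK cK]] := Hs h lh go fh.
have Q0 : 0 < Q by apply: leq_ltn_trans qQ.
apply: (@clique_minor_sub _ (edge_adj K)).
  by move=> x y /andP[xy xyK]; rewrite /edge_adj /= xy (subsetP KE).
apply: (girth_dense_clique_minor (a := a) (i := i) (L := (8 * (a * i)).+2)) => //.
- by move=> x y; rewrite /edge_adj /= eq_sym setUC.
- by move=> x; rewrite /edge_adj /= eqxx.
- by rewrite card_ord ltnW.
- by rewrite addn1.
rewrite card_ord; apply: leq_trans (leq_mul (leqnn a) (card_edge_adj Kc)).
have : Q * (a.+1 * n) <= Q * (a * #|K|).
  have := leq_trans num (leq_mul (leqnn a) cK).
  rewrite [_ + 3]addn3; move: (4 ^ _) #|K| => X Y; clear.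
  by rewrite mulnDr [a * (_ + _)]mulnDr [a * (Q * X)]mulnA leq_add2r mulnC [a * (Q * _)]mulnCA.
by rewrite leq_pmul2l // => le; move: le; move: #|K| => Y; clear; nia.
Qed.

(** Handles the targets too small for the parameter choice below: any claimed edge will do. *)
Lemma client_builds_edge n q t : 1 < n -> t <= 2 ->
  client_can_build q (complete_edges n) (fun E => has_clique_minor (edge_adj E) t).
Proof.
move=> n1 t2; apply: (@client_build_of_invariant _ _ _ (legal q (complete_edges n)) set0) => //.
  case=> [|[A e] h].
    rewrite /game_over /Defs.free big_nil setD0 => _ /eqP/setP/(_ [set Ordinal (ltnW n1); Ordinal n1]).
    by rewrite !inE cards2.
  rewrite /= => /and3P[_ /andP[/subsetP Af _] eA] _.
  have := Af e eA; rewrite in_setD inE => /andP[_ /cards2P[x [y [xy exy]]]].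
  exists (fun i : 'I_t => if i == 0 :> nat then [set x] else [set y]).
  have two (i : 'I_t) : i = 0 :> nat \/ i = 1 :> nat by have := ltn_ord i; lia.
  split=> [i j|i|i j ij].
  - rewrite -val_eqE /=; case: (two i) => ->; case: (two j) => -> //= _.
      by rewrite disjoints1 inE.
    by rewrite disjoints1 inE eq_sym.
  - by case: ifP => _; (split; first by rewrite -card_gt0 cards1);
      move=> u w /set1P-> /set1P->; exact: connect0.
  - exists x, y; have [-> ->] : i = 0 :> nat /\ j = 1 :> nat by have := ltn_ord j; lia.
    by rewrite /edge_adj /= xy client_claims_cons -exy !inE !eqxx.
move=> h A lh _ lA; have /card_gt0P[x xA] : 0 < #|A| by case/and3P: lA.
by exists x => //=; rewrite lh lA.
Qed.

(** * Choice of the parameters *)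

Section Numerics.

Import Order.TTheory GRing.Theory Num.Theory.
Local Open Scope ring_scope.
Variable R : realType.
Implicit Types x y X eps : R.

Lemma absz_ceil_itv x : 0 <= x -> x <= `|Num.ceil x|%N%:R < x + 1.
Proof.
move=> x0; have c0 : 0 <= Num.ceil x by rewrite ceil_ge0 (lt_le_trans _ x0) ?ltrN10.
rewrite natr_absz (ger0_norm c0) ceil_ge /=.
by have := ceilB1_lt x; rewrite intrB ltrBlDr.
Qed.

Lemma exists_pow2 x : 1 <= x -> exists i : nat, x <= 2 ^+ i <= 2 * x.
Proof.
move=> x1; have ex : exists i : nat, x <= 2 ^+ i.
  have x0 : 0 <= x by exact: le_trans x1.
  have /andP[h _] := absz_ceil_itv x0.
  exists `|Num.ceil x|%N; apply: le_trans h _.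
  by rewrite -natrX ler_nat ltnW // ltn_expl.
exists (ex_minn ex); case: ex_minnP => -[|i] xi imin; rewrite xi /=.
  by rewrite expr0; lra.
have : 2 ^+ i < x by rewrite ltNge; apply/negP => /imin; rewrite ltnn.
by rewrite exprS => /ltW; rewrite ler_pM2l.
Qed.

(* With [c = 1/2240], [a <= 5/eps] and [2^i <= x^7] the number of short cycles
   is at most about [2^(16 a i) <= x^(112 a) <= (eps n)^(560 c) = (eps n)^(1/4)]. *)
Lemma parameters eps X : 0 < eps -> eps <= 2^-1 -> 0 < X ->
  2 < X `^ (2240^-1 * eps) ->
  exists a i : nat, [/\ 4 <= a%:R * eps,
    (3 * (`|Num.ceil (X `^ (2240^-1 * eps))| * `|Num.ceil (X `^ (2240^-1 * eps))| +
       `|Num.ceil (X `^ (2240^-1 * eps))|) <= 2 ^ i)%N,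
    2 * 4 ^+ (8 * (a * i) + 3) <= X & 16 <= X].
Proof.
move=> e0 e1 X0; set x := X `^ _ => x2.
have X1 : 1 <= X.
  rewrite leNgt; apply/negP => X1.
  have : x <= 1 `^ (2240^-1 * eps).
    by rewrite /x ge0_ler_powR ?nnegrE ?ltW // mulr_gt0 ?invr_gt0.
  by rewrite powR1; lra.
have x1 : 1 <= x by lra.
(* The exponent 6 suffices because the target [t] is at most [3 / 2 * x], so that
   [3 * (t * t + t) <= 9 * x ^+ 2]; and [2 * x ^+ 6 <= x ^+ 7]. *)
have [i /andP[xi ix]] : exists i : nat, x ^+ 6 <= 2 ^+ i <= 2 * x ^+ 6.
  by apply: exists_pow2; rewrite exprn_ege1.
have /absz_ceil_itv : 0 <= 4 / eps by rewrite divr_ge0 ?ltW.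
set a := `|_|%N => /andP[a1 a2].
have a4 : 4 <= a%:R * eps by rewrite -ler_pdivrMr.
have a5 : a%:R * eps <= 5.
  have : a%:R * eps < (4 / eps + 1) * eps by rewrite ltr_pM2r.
  by rewrite mulrDl divfK ?gt_eqF // mul1r; lra.
pose y := X `^ (4^-1).
have y4 : y ^+ 4 = X.
  by rewrite -powR_mulrn ?powR_ge0 // -powRrM mulVf ?pnatr_eq0 // powRr1 // ltW.
(* The exponent of [X] is [112 / 2240 * (a * eps) <= 5 / 20]. *)
have yx : x ^+ (112 * a) <= y.
  rewrite -powR_mulrn; last lra.
  rewrite -powRrM ler_powR // natrM.
  have -> : 2240^-1 * eps * (112%:R * a%:R) = 20^-1 * (a%:R * eps) by field.
  lra.
clearbody y x a.
have a0 : (0 < a)%N.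
  by rewrite lt0n; apply/eqP => a0; move: a4; rewrite a0 mul0r; lra.
have y128 : 128 <= y.
  apply: le_trans yx.
  have -> : 128 = 2 ^+ 7 :> R by rewrite -natrX.
  apply: (@le_trans _ _ (2 ^+ (112 * a))).
    by rewrite ler_weXn2l ?ler1n // (leq_trans _ (leq_pmulr 112 a0)).
  by rewrite lerXn2r ?nnegrE //; lra.
have bigX : 128 * y <= X.
  have y0 : 0 < y by lra.
  rewrite -y4 exprS mulrC ler_pM2l //.
  by apply: (le_trans (y128)); rewrite ler_eXnr //; lra.
exists a, i; split=> //.
- have /absz_ceil_itv : 0 <= x by lra.
  set t := `|_|%N => /andP[_ t1].
  rewrite -(ler_nat R) natrX natrM natrD natrM; apply: le_trans xi.
  have t2 : t%:R <= 3 / 2 * x by lra.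
  have t0 : 0 <= t%:R :> R by [].
  have h1 : t%:R * t%:R <= (3 / 2 * x) * (3 / 2 * x) by rewrite ler_pM.
  have h2 : 16 * x ^+ 2 <= x ^+ 6.
    rewrite (_ : 6 = 4 + 2)%N // exprD ler_pM2r ?exprn_gt0 //; last lra.
    have -> : 16 = 2 ^+ 4 :> R by rewrite -natrX.
    by rewrite lerXn2r ?nnegrE //; lra.
  have h3 : 2 * x <= x ^+ 2 by rewrite expr2 ler_pM2r; lra.
  have h4 : (3 / 2 * x) * (3 / 2 * x) = 9 / 4 * x ^+ 2 by field.
  rewrite h4 in h1; move: (t%:R * t%:R) (x ^+ 2) (x ^+ 6) h1 h2 h3 => A B C; lra.
- have h : 4 ^+ (8 * (a * i) + 3) <= 64 * y :> R.
    rewrite exprD mulrC; have -> : 4 ^+ 3 = 64 :> R by rewrite -natrX.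
    rewrite ler_pM2l //; apply: le_trans yx.
    have -> : 4 ^+ (8 * (a * i)) = (2 ^+ i) ^+ (16 * a) :> R.
      have -> : 4 = 2 ^+ 2 :> R by rewrite -natrX.
      by rewrite -!exprM; congr (_ ^+ _); clear; lia.
    rewrite (_ : 112 * a = 7 * (16 * a))%N; last by rewrite mulnA.
    have x0 : 0 < x by lra.
    rewrite [x ^+ (7 * _)]exprM lerXn2r ?nnegrE ?exprn_ge0 ?(ltW x0) //.
    by apply: le_trans ix _; rewrite [x ^+ 7]exprS ler_pM2r ?exprn_gt0 //; lra.
  by lra.
- by lra.
Qed.

End Numerics.

(** * Assembly of both sides *)

Import Order.TTheory GRing.Theory Num.Theory.
Local Open Scope ring_scope.

Theorem theorem1p3 (R : realType) :
  exists (c : R) (n0 : nat), 0 < c /\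
    forall n : nat, (n0 <= n)%N -> forall eps : R, 0 < eps ->
      (forall q : nat, (0 < q)%N -> n%:R / 2 - 1 <= q%:R :> R ->
         waiter_can_maintain q (complete_edges n)
           (fun E => ~ has_clique_minor (edge_adj E) 3)) /\
      (forall q : nat, (0 < q)%N -> q%:R <= (2^-1 - eps) * n%:R ->
         client_can_build q (complete_edges n)
           (fun E => has_clique_minor (edge_adj E)
              `|Num.ceil ((eps * n%:R) `^ (c * eps))|%N)).
Proof.
exists 2240^-1, 2%N; split=> [|n n2 eps e0]; first by rewrite invr_gt0.
split=> q q0 hq.
  apply: waiter_keeps_forest; first exact: ltnW.
  rewrite -(ler_nat R) -muln2 natrM -natr1; lra.
have n0 : 0 < n%:R :> R by rewrite ltr0n ltnW.
have q0' : 0 < q%:R :> R by rewrite ltr0n.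
have e1 : eps <= 2^-1.
  have : 0 < (2^-1 - eps) * n%:R by exact: lt_le_trans hq.
  by rewrite pmulr_lgt0 // subr_gt0 => /ltW.
set X := eps * n%:R; have X0 : 0 < X by rewrite mulr_gt0.
set x := X `^ _; have x0 : 0 <= x by exact: powR_ge0.
have [x2|x2] := leP x 2.
  apply: client_builds_edge => //.
  have /andP[_ ] := absz_ceil_itv x0; rewrite -ltnS -(ltr_nat R); lra.
have [a [i [a4 ti Z X16]]] := parameters e0 e1 X0 x2.
rewrite -/x in ti; clearbody x; move: Z.
have a0 : (0 < a)%N.
  by rewrite lt0n; apply/eqP => a0; move: a4; rewrite a0 mul0r; lra.
have t0 : (0 < `|Num.ceil x|)%N.
  by have /andP[h _] := absz_ceil_itv x0; rewrite -(ltr_nat R); lra.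
(* The first entry respects the bias, the second keeps [n / Q] at most 4 when [q] is small. *)
pose Q := maxn q.+1 (n %/ 4).+1.
have n16 : 16 <= n%:R :> R.
  by apply: le_trans X16 _; rewrite /X ler_piMl ?ltW //; lra.
(* Equivalently, the expected number ['C(n, 2) / Q] of kept edges is at least [(1 + eps) * n]. *)
have hQ : 2 * (1 + eps) * Q%:R <= n%:R - 1.
  have [Q1|Q2] : Q%:R <= (2^-1 - eps) * n%:R + 1 \/ Q%:R <= n%:R / 4 + 1 :> R.
    rewrite /Q; case: (leqP q.+1 (n %/ 4).+1) => _; [right|left]; rewrite -natr1 lerD2r //.
    by rewrite ler_pdivlMr // -natrM ler_nat leq_trunc_div.
  - apply: (@le_trans _ _ (2 * (1 + eps) * ((2^-1 - eps) * n%:R + 1))).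
      by rewrite ler_pM2l //; lra.
    have -> : 2 * (1 + eps) * ((2^-1 - eps) * n%:R + 1) =
        n%:R - X - 2 * eps * X + 2 + 2 * eps by rewrite /X; field.
    have : 0 <= eps * X by rewrite mulr_ge0 ?ltW.
    by lra.
  - apply: (@le_trans _ _ (3 * (n%:R / 4 + 1))).
      by apply: ler_pM => //; [lra|lra].
    by lra.
move=> Z; apply: (@client_builds_clique_minor n q Q a i) => //.
- by rewrite /Q leq_maxl.
- by rewrite /Q; clear; lia.
set Zn := (4 ^ _)%N.
have Z' : 2 * Zn%:R <= X by rewrite natrX.
have bin : 2 * 'C(n, 2)%:R = n%:R * (n%:R - 1) :> R.
  have := mul_bin_diag n 1; rewrite bin1 => e.
  rewrite -natrM -e natrM; congr (_ * _).
  by case: (n) n2 => // m _; rewrite -natr1 addrK.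
rewrite -(ler_nat R) natrD !natrM -natr1.
rewrite -(@ler_pM2l _ 2) // mulrCA bin.
have h1 : a%:R * n%:R * (2 * (1 + eps) * Q%:R) <= a%:R * n%:R * (n%:R - 1).
  by rewrite ler_wpM2l // mulr_ge0.
rewrite mulrA; apply: le_trans h1.
(* The surplus [a * eps * n = a * X] pays for raising [a * n] to [a.+1 * n], at most a quarter of
   it, and for the short cycles, at most half. *)
have h2 : n%:R + a%:R * Zn%:R <= a%:R * X.
  have h3 : a%:R * (2 * Zn%:R) <= a%:R * X by rewrite ler_wpM2l.
  have h4 : 4 * n%:R <= a%:R * X by rewrite /X mulrA ler_pM2r.
  by lra.
have h5 : 2 * Q%:R * (n%:R + a%:R * Zn%:R) <= 2 * Q%:R * (a%:R * X).
  by rewrite ler_wpM2l // mulr_ge0.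
by move: h5; rewrite /X => h5; lra.
Qed.
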